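(* Let $b,c\in\mathbb{C}\setminus\{0\}$, $d\in\mathbb{C}$, and $M(z)=\dfrac{b}{cz+d}$. Then for Stirling's method $St_M(z)=z+\dfrac{\big((cz+d)^2-bc\big)^2}{c(cz+d)^3}$: (i) $St_M$ is a rational map of degree $4$ and has $6$ critical points (counted with multiplicity); (ii) $\infty$ is an attracting fixed point of $St_M$ (with multiplier $\tfrac12$); (iii) the number of cycles of Herman rings of $St_M$ is at most $1$; (iv) the Julia set $J(St_M)$ is disconnected.
   Context: For a non-constant rational function $f$, Stirling's iterative root-finding method is the map $St_f(z)=z-\dfrac{f(z)}{f'\big(z-f(z)\big)}$, regarded as a rational self-map of $\widehat{\mathbb{C}}$. The multiplier of a fixed point at $\infty$ of a rational map $F$ is $G'(0)$, where $G(z)=1/F(1/z)$. A Herman ring is a doubly connected periodic Fatou component $U$ of period $p$ on which $F^p$ is conformally conjugate to an irrational rotation of a round annulus. The Julia set is the complement of the Fatou set (the set where the iterates form a normal family locally). *)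

(* Defs.v *)
From mathcomp Require Import all_boot all_order all_algebra.
From mathcomp Require Import complex.
From mathcomp Require Import all_classical all_reals all_analysis.
Import Order.TTheory GRing.Theory Num.Theory.

Set Implicit Arguments.
Unset Strict Implicit.
Unset Printing Implicit Defensive.

Local Open Scope ring_scope.
Local Open Scope classical_set_scope.

Section Dynamics.
Variable R : realType.
Local Notation C := R[i].

(* The Riemann sphere: [Some z] is the finite point z, [None] is infinity. *)
Definition sphere := option C.

Definition cabs (z : C) : R :=
  Num.sqrt (complex.Re z ^+ 2 + complex.Im z ^+ 2).

Definition sdist (x y : sphere) : R :=
  match x, y with
  | Some z, Some w =>
      2 * cabs (z - w) / Num.sqrt ((1 + cabs z ^+ 2) * (1 + cabs w ^+ 2))
  | Some z, None | None, Some z => 2 / Num.sqrt (1 + cabs z ^+ 2)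
  | None, None => 0
  end.

Definition sopen (U : set sphere) : Prop :=
  forall x, U x -> exists2 e : R, 0 < e & forall y, sdist x y < e -> U y.

Definition sconnected (A : set sphere) : Prop :=
  ~ exists O1 O2 : set sphere,
      [/\ sopen O1 /\ sopen O2, A `<=` O1 `|` O2,
          A `&` O1 !=set0, A `&` O2 !=set0 & A `&` O1 `&` O2 = set0].

Definition is_component (A K : set sphere) : Prop :=
  [/\ K `<=` A, K !=set0, sconnected K &
      forall L, K `<=` L -> L `<=` A -> sconnected L -> L = K].

(* A rational map is given by a numerator and a denominator polynomial. *)
Definition ratmap := ({poly C} * {poly C})%type.

Definition is_rational_map (pq : ratmap) : Prop :=
  pq.2 != 0 /\ coprimep pq.1 pq.2.

(* degree = max of the degrees of numerator and denominator in lowest terms *)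
Definition rdeg (pq : ratmap) : nat := (maxn (size pq.1) (size pq.2)).-1.

Definition rat_eval (pq : ratmap) (x : sphere) : sphere :=
  let: (p, q) := pq in
  match x with
  | Some z => if q.[z] != 0 then Some (p.[z] / q.[z]) else None
  | None => if (size q < size p)%N then None
            else if size p == size q then Some (lead_coef p / lead_coef q)
            else Some 0
  end.

Definition locdeg_fin (p q : {poly C}) (z : C) : nat :=
  if q.[z] != 0 then mup z (p - (p.[z] / q.[z]) *: q) else mup z q.

(* u^n p(1/u) *)
Definition homrev (n : nat) (p : {poly C}) : {poly C} :=
  \poly_(i < n.+1) p`_(n - i).

(* local degree (multiplicity) of the rational map at a point of the sphere;
   at infinity one uses the chart u = 1/z in the source *)
Definition local_degree (pq : ratmap) (x : sphere) : nat :=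
  match x with
  | Some z => locdeg_fin pq.1 pq.2 z
  | None => locdeg_fin (homrev (rdeg pq) pq.1) (homrev (rdeg pq) pq.2) 0
  end.

Definition num_crit_points (pq : ratmap) (N : nat) : Prop :=
  exists s : seq sphere,
    [/\ uniq s, forall x, x \notin s -> local_degree pq x = 1%N &
        (\sum_(x <- s) (local_degree pq x).-1)%N = N].

Definition conv_locunif (f : nat -> sphere -> sphere) (g : sphere -> sphere)
    (U : set sphere) : Prop :=
  forall x, U x -> exists V : set sphere,
    [/\ sopen V, V x, V `<=` U &
        forall e : R, 0 < e -> exists N : nat, forall n, (N <= n)%N ->
          forall y, V y -> sdist (f n y) (g y) < e].

Definition iterates_normal (F : sphere -> sphere) (U : set sphere) : Prop :=
  forall n_ : nat -> nat, exists phi : nat -> nat,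
    (forall k, (phi k < phi k.+1)%N) /\
    exists g : sphere -> sphere, conv_locunif (fun k => iter (n_ (phi k)) F) g U.

Definition fatou_set (F : sphere -> sphere) : set sphere :=
  [set x | exists U, [/\ sopen U, U x & iterates_normal F U]].

Definition julia_set (F : sphere -> sphere) : set sphere := ~` fatou_set F.

Definition holo_on (phi : sphere -> C) (U : set sphere) : Prop :=
  forall x, U x ->
    match x with
    | Some z => derivable (fun w : C^o => (phi (Some w) : C^o)) (z : C^o) (1 : C^o)
    | None => derivable (fun u : C^o => (phi (if u == 0 then None else Some u^-1) : C^o))
                        (0 : C^o) (1 : C^o)
    end.

Definition irrational (t : R) : Prop := forall q : rat, t != ratr q.

Definition rotation_factor (theta : R) : C :=
  (cos (2 * pi * theta) +i* sin (2 * pi * theta))%C.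

Definition doubly_connected (U : set sphere) : Prop :=
  exists K1 K2, [/\ is_component (~` U) K1, is_component (~` U) K2, K1 <> K2 &
                    forall K, is_component (~` U) K -> K = K1 \/ K = K2].

Definition herman_ring (F : sphere -> sphere) (U : set sphere) : Prop :=
  [/\ is_component (fatou_set F) U, doubly_connected U &
      exists p : nat,
      [/\ (0 < p)%N, iter p F @` U = U,
          forall k, (0 < k < p)%N -> iter k F @` U <> U &
          exists (r1 r2 theta : R) (phi : sphere -> C),
            [/\ 0 < r1 < r2 /\ irrational theta, holo_on phi U,
                {in U &, injective phi},
                phi @` U = [set w | r1 < cabs w < r2] &
                forall x, U x -> phi (iter p F x) = rotation_factor theta * phi x]]].

(* the map at infinity in the chart u = 1/z : G(u) = 1/F(1/u) *)
Definition chart_infty (F : sphere -> sphere) (u : C) : C :=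
  match F (if u == 0 then None else Some u^-1) with
  | None => 0
  | Some w => w^-1
  end.

Definition attracting_fixed_infty (F : sphere -> sphere) : Prop :=
  F None = None /\
  exists m : C, is_derive (0 : C^o) (1 : C^o) (chart_infty F : C^o -> C^o) m
                /\ cabs m < 1.

Definition moebM (b c d : C) (z : C) : C := b / (c * z + d).

(* Stirling's method for M: St_M(z) = z + ((cz+d)^2 - bc)^2 / (c (cz+d)^3),
   as numerator / denominator *)
Definition stM (b c d : C) : ratmap :=
  let L := c *: 'X + d%:P in
  (c *: 'X * L ^+ 3 + (L ^+ 2 - (b * c)%:P) ^+ 2, c *: L ^+ 3).

End Dynamics.

(* Main.v *)
(** In the coordinate w = (c z + d) / s with s^2 = b c, the map St_M becomes
    w |-> 2 w - 2 / w + 1 / w^3, whatever the values of b, c and d. The set E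
    formed by infinity, the imaginary axis and |w| > 3 is connected, is attracted
    to infinity, and contains both preimages 0 and infinity of infinity.

    J is disconnected because it misses E while containing the two parabolic fixed
    points w = 1 and w = -1, on either side of the imaginary axis.

    There is no Herman ring at all. Let U be one; its forward orbit misses E, and
    its complement has two components, K1 containing E and K2. If F^n(K2) misses
    E, then the part of E covered by F^(n+1)(K2) is closed, and also open since it
    equals the part covered by the open set F^(n+1)(U `|` K2); it is therefore
    empty or all of E, and the latter would put 0 or infinity in F^n(K2). Hence
    the iterates are bounded on the open set U `|` K2, so they are normal there
    (maximum modulus and Arzela-Ascoli), and the Fatou component U would extend
    across the boundary of K2. *)
Require Import Defs.
From HB Require Import structures.
From mathcomp Require Import all_boot all_order all_algebra.
From mathcomp Require Import complex ring lra.
From mathcomp Require Import all_classical all_reals all_analysis.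
Import Order.TTheory GRing.Theory Num.Theory.
Import numFieldNormedType.Exports.

Set Implicit Arguments.
Unset Strict Implicit.
Unset Printing Implicit Defensive.

Local Open Scope ring_scope.
Local Open Scope classical_set_scope.

(** * The complex modulus *)

Section Modulus.
Variable R : realType.
Local Notation C := R[i].
Implicit Types (x y z w : C).

Lemma cabsE z : `|z| = (cabs z)%:C%C.
Proof. exact: normc_def. Qed.

Lemma cabs_ge0 z : 0 <= cabs z.
Proof. exact: sqrtr_ge0. Qed.

Lemma cabs0 : cabs (0 : C) = 0.
Proof. by apply: complexI; rewrite -cabsE normr0. Qed.

Lemma cabs1 : cabs (1 : C) = 1.
Proof. by apply: complexI; rewrite -cabsE normr1. Qed.

Lemma cabs_eq0 z : (cabs z == 0) = (z == 0).
Proof. by rewrite -[RHS]normr_eq0 cabsE -[0 in RHS]/(0%:C)%C (inj_eq (@complexI R)). Qed.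

Lemma cabs_gt0 z : (0 < cabs z) = (z != 0).
Proof. by rewrite lt0r cabs_ge0 andbT cabs_eq0. Qed.

Lemma cabsM z w : cabs (z * w) = cabs z * cabs w.
Proof. by apply: complexI; rewrite rmorphM/= -!cabsE normrM. Qed.

Lemma cabsN z : cabs (- z) = cabs z.
Proof. by apply: complexI; rewrite -!cabsE normrN. Qed.

Lemma cabs_distC z w : cabs (z - w) = cabs (w - z).
Proof. by rewrite -cabsN opprB. Qed.

Lemma cabsV z : cabs z^-1 = (cabs z)^-1.
Proof. by apply: complexI; rewrite fmorphV/= -!cabsE normfV. Qed.

Lemma cabsf_div z w : cabs (z / w) = cabs z / cabs w.
Proof. by rewrite cabsM cabsV. Qed.

Lemma cabsX z n : cabs (z ^+ n) = cabs z ^+ n.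
Proof. by apply: complexI; rewrite rmorphXn/= -!cabsE normrX. Qed.

Lemma cabsD z w : cabs (z + w) <= cabs z + cabs w.
Proof. by rewrite -lecR rmorphD/= -!cabsE ler_normD. Qed.

Lemma cabsB z w : cabs z - cabs w <= cabs (z - w).
Proof. by rewrite lerBlDr (le_trans _ (cabsD _ _))// subrK. Qed.

Lemma cabsBD z w : cabs (z - w) <= cabs z + cabs w.
Proof. by rewrite -[cabs w]cabsN cabsD. Qed.

Lemma cabs_dist_trans y x z : cabs (x - z) <= cabs (x - y) + cabs (y - z).
Proof. by rewrite (le_trans _ (cabsD _ _))// addrA subrK. Qed.

Lemma cabsr (a : R) : cabs (a%:C)%C = `|a|.
Proof. by rewrite /cabs/= expr0n addr0 sqrtr_sqr. Qed.

Lemma cabs_nat n : cabs (n%:R : C) = n%:R.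
Proof. by rewrite -(rmorph_nat (real_complex R)) cabsr normr_nat. Qed.

Lemma cabs_Re z : `|complex.Re z| <= cabs z.
Proof. by rewrite -sqrtr_sqr ler_sqrt ?lerDl ?addr_ge0 ?sqr_ge0. Qed.

Lemma cabs_Im z : `|complex.Im z| <= cabs z.
Proof. by rewrite -sqrtr_sqr ler_sqrt ?lerDr ?addr_ge0 ?sqr_ge0. Qed.

Lemma cabs_ReIm z : cabs z <= `|complex.Re z| + `|complex.Im z|.
Proof.
rewrite -[X in _ <= X]ger0_norm ?addr_ge0// -sqrtr_sqr ler_sqrt ?sqr_ge0//.
rewrite sqrrD !real_normK ?num_real//.
have : 0 <= `|complex.Re z| * `|complex.Im z| by rewrite mulr_ge0.
lra.
Qed.

(** The norm of [C^o] is complex valued, so its balls have radii in [C]; this restates its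
    neighbourhoods with real radii. *)
Lemma nbhs_cabsP z (A : set C) :
  nbhs (z : C^o) A <-> exists2 r : R, 0 < r & forall w, cabs (w - z) < r -> A w.
Proof.
split=> [[e /= e0 eA]|[r r0 rA]].
  exists (complex.Re e); first by move: e0; rewrite ltcE => /andP[].
  move=> w zw; apply: eA; rewrite /= cabsE cabs_distC.
  have -> : e = (complex.Re e)%:C%C by rewrite RRe_real// gtr0_real.
  by rewrite ltcR.
exists r%:C%C; first by rewrite /= -[0]/(0%:C)%C ltcR.
by move=> w /=; rewrite cabsE ltcR cabs_distC; apply: rA.
Qed.

Lemma cabs_continuous : continuous (@cabs R : C^o -> R).
Proof.
move=> z A /nbhs_ballP[e /= e0 eA]; apply/nbhs_cabsP; exists e => // w zw.
apply: eA; rewrite /ball/=.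
apply: le_lt_trans zw; rewrite ler_norml; apply/andP; split.
  by rewrite lerNl opprB cabsB.
by rewrite cabs_distC cabsB.
Qed.

End Modulus.

(** * Topology of the sphere *)

Section SphereTopology.
Variable R : realType.
Local Notation C := R[i].
Local Notation sphere := (sphere R).

(** The topology of the one-point compactification, given without the chordal distance.
    [nbhs_sdistP] shows that the two agree, which turns [sopen] and [sconnected] into the library
    notions. *)
Definition sphere_nbhs (x : sphere) : set_system sphere :=
  match x with
  | Some z => [set A | nbhs (z : C^o) (fun w => A (Some w))]
  | None => [set A | A None /\
      exists M : R, forall w : C, M < cabs w -> A (Some w)]
  end.

Lemma sphere_nbhs_filter x : ProperFilter (sphere_nbhs x).
Proof.
case: x => [z|].
  split=> [/= /nbhs_singleton//|]; split => [|A B /= nA nB|A B AB /=].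
  - exact: filterT.
  - exact: filterI.
  - by apply: filterS => w /AB.
split=> [[]//|]; split => [|A B [nA [M MA]] [nB [N NB]]|A B AB [nA [M MA]]].
- by split=> //; exists 0.
- split; first by split.
  exists (Num.max M N) => w; rewrite gt_max => /andP[Mw Nw].
  by split; [exact: MA|exact: NB].
- by split; [exact: AB|exists M => w /MA/AB].
Qed.

Lemma sphere_nbhs_singleton (x : sphere) A : sphere_nbhs x A -> A x.
Proof. by case: x => [z /= /nbhs_singleton|[]]. Qed.

Lemma sphere_nbhs_nbhs (x : sphere) A :
  sphere_nbhs x A -> sphere_nbhs x (sphere_nbhs^~ A).
Proof.
case: x => [z /= /nbhs_interior|[nA [M MA]]]; first exact: filterS.
split; first by split => //; exists M.
exists M => w Mw /=; apply/nbhs_cabsP; exists (cabs w - M); first by rewrite subr_gt0.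
move=> v vw; apply: MA; have := cabsB w v; rewrite cabs_distC; lra.
Qed.

HB.instance Definition _ := Choice.copy sphere (option C).
HB.instance Definition _ := hasNbhs.Build sphere sphere_nbhs.
HB.instance Definition _ := @Nbhs_isNbhsTopological.Build sphere
  sphere_nbhs_filter sphere_nbhs_singleton sphere_nbhs_nbhs.

Lemma nbhs_SomeP (z : C) (A : set sphere) : nbhs (Some z : sphere) A <->
  exists2 r : R, 0 < r & forall w, cabs (w - z) < r -> A (Some w).
Proof. exact: nbhs_cabsP. Qed.

Lemma nbhs_NoneP (A : set sphere) : nbhs (None : sphere) A <->
  A None /\ exists M : R, forall w : C, M < cabs w -> A (Some w).
Proof. by []. Qed.

Lemma sdist_Some_le (z w : C) : sdist (Some z) (Some w) <= 2 * cabs (z - w).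
Proof.
rewrite /= ler_pdivrMr.
  rewrite ler_peMr ?mulr_ge0 ?cabs_ge0// -[X in X <= _]sqrtr1 ler_sqrt//.
    have := sqr_ge0 (cabs z); have := sqr_ge0 (cabs w); nra.
  by have := sqr_ge0 (cabs z); have := sqr_ge0 (cabs w); nra.
rewrite sqrtr_gt0; have := sqr_ge0 (cabs z); have := sqr_ge0 (cabs w); nra.
Qed.

Lemma sqrtD1_le (a : R) : 0 <= a -> Num.sqrt (1 + a ^+ 2) <= 1 + a.
Proof.
move=> a0; rewrite -[X in _ <= X]ger0_norm ?addr_ge0// -sqrtr_sqr ler_sqrt ?sqr_ge0//.
nra.
Qed.

Lemma sqrtD1_ge (a : R) : 0 <= a -> a <= Num.sqrt (1 + a ^+ 2).
Proof.
by move=> a0; rewrite -[X in X <= _]ger0_norm// -sqrtr_sqr ler_sqrt ?addr_ge0 ?sqr_ge0// lerDr.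
Qed.

Lemma sqrtD1_gt0 (a : R) : 0 < Num.sqrt (1 + a ^+ 2).
Proof. by rewrite sqrtr_gt0 ltr_wpDr ?sqr_ge0. Qed.

Lemma sdist_Some_ge (z w : C) :
  2 * cabs (z - w) / ((1 + cabs z) * (1 + cabs w)) <= sdist (Some z) (Some w).
Proof.
rewrite /= ler_wpM2l ?mulr_ge0 ?cabs_ge0// lef_pV2 ?posrE.
- rewrite sqrtrM ?addr_ge0 ?sqr_ge0//.
  by rewrite ler_pM ?sqrtr_ge0 ?sqrtD1_le ?cabs_ge0.
- by rewrite mulr_gt0 ?ltr_wpDr ?cabs_ge0.
- by rewrite sqrtrM ?addr_ge0 ?sqr_ge0// mulr_gt0 ?sqrtD1_gt0.
Qed.

Lemma sdist_None_lt (w : C) (e : R) : 0 < e ->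
  2 / e < cabs w -> sdist None (Some w) < e.
Proof.
move=> e0 ew /=; rewrite ltr_pdivrMr ?sqrtD1_gt0//.
move: ew; rewrite ltr_pdivrMr// => ew.
by rewrite (lt_le_trans ew)// [e * _]mulrC ler_wpM2r ?sqrtD1_ge ?cabs_ge0// ltW.
Qed.

Lemma sdistC (x y : sphere) : sdist x y = sdist y x.
Proof.
by case: x y => [z|] [w|] //=; rewrite cabs_distC [X in Num.sqrt X]mulrC.
Qed.

Lemma sdistxx (x : sphere) : sdist x x = 0.
Proof. by case: x => [z|] //=; rewrite subrr cabs0 mulr0 mul0r. Qed.

Lemma nbhs_sdistP (x : sphere) (A : set sphere) : nbhs x A <->
  exists2 e : R, 0 < e & forall y, sdist x y < e -> A y.
Proof.
case: x => [z|].
  rewrite nbhs_SomeP; split=> [[r r0 rA]|[e e0 eA]]; last first.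
    exists (e / 2); first by rewrite divr_gt0.
    move=> w wz; apply: eA; rewrite (le_lt_trans (sdist_Some_le _ _))//.
    by rewrite cabs_distC; lra.
  set a := cabs z; have a0 : 0 <= a := cabs_ge0 z.
  (* The first bound is the distance from [z] to infinity and excludes [None]; the second is what
     [sdist_Some_ge] guarantees once [w] is at Euclidean distance at least [r] from [z]. *)
  exists (Num.min (2 / Num.sqrt (1 + a ^+ 2)) (2 * r / ((1 + a) * (1 + a + r)))).
    rewrite lt_min divr_gt0 ?sqrtD1_gt0//= divr_gt0 ?mulr_gt0//; lra.
  case=> [w|] /=; rewrite lt_min => /andP[d1 d2]; last by rewrite ltxx in d1.
  apply: rA; rewrite ltNge; apply/negP => rw; move: d2; apply/negP; rewrite -leNgt.
  apply: le_trans (sdist_Some_ge _ _); rewrite -/a.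
  have w1 : cabs w <= a + cabs (w - z) by have := cabsD (w - z) z; rewrite subrK /a; lra.
  set t := cabs (w - z) in rw w1; rewrite cabs_distC -/t.
  have w0 := cabs_ge0 w.
  rewrite ler_pdivrMr ?mulr_gt0//; [|lra|lra].
  rewrite mulrAC ler_pdivlMr ?mulr_gt0//; [|lra|lra].
  set q := cabs w in w1 w0 *.
  have h1 : r * (1 + q) <= t * (1 + a + r) by nra.
  have -> : 2 * r * ((1 + a) * (1 + q)) = (2 * (1 + a)) * (r * (1 + q)) by ring.
  have -> : 2 * t * ((1 + a) * (1 + a + r)) = (2 * (1 + a)) * (t * (1 + a + r)) by ring.
  rewrite ler_wpM2l//; lra.
rewrite nbhs_NoneP; split=> [[A0 [M MA]]|[e e0 eA]]; last first.
  split; first by apply: eA; rewrite sdistxx.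
  by exists (2 / e) => w ew; apply: eA; exact: sdist_None_lt.
pose m := Num.max M 0; have m0 : 0 <= m by rewrite le_max lexx orbT.
exists (2 / (1 + m)); first by rewrite divr_gt0// ltr_wpDr.
case=> [w|//] /=.
rewrite ltr_pM2l// ltf_pV2 ?posrE ?sqrtD1_gt0 ?ltr_wpDr// => mw.
apply: MA; rewrite (@le_lt_trans _ _ m)//; first by rewrite le_max lexx.
have := lt_le_trans mw (sqrtD1_le (cabs_ge0 w)); lra.
Qed.

Lemma sopenE (U : set sphere) : sopen U = open U.
Proof.
rewrite openE propeqE; split=> oU x Ux; first exact/nbhs_sdistP/oU.
exact/nbhs_sdistP/oU.
Qed.

Lemma sconnectedE (A : set sphere) : sconnected A = connected A.
Proof.
rewrite propeqE; split=> [cA|cA].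
  move=> B B0 [G1 oG1 B1] [K cK B2]; apply: contrapT => BA; apply: cA.
  exists G1, (~` K); split.
  - by rewrite !sopenE; split => //; exact: closed_openC.
  - move=> x Ax; have [Kx|nKx] := pselect (K x); [left|by right].
    by have : B x; [rewrite B2|rewrite B1 => -[]].
  - by rewrite -B1.
  - apply: contrapT => h; apply: BA; rewrite B2; apply/setIidPl => x Ax.
    by apply: contrapT => nKx; apply: h; exists x.
  - by rewrite -B1 B2; apply/seteqP; split => x // [[_ Kx] /(_ Kx)].
case=> G1 [G2 [[]]]; rewrite !sopenE => oG1 oG2 AO A1 [y [Ay G2y]] A12.
have AE : A `&` G1 = A.
  apply: (cA _ A1); first by exists G1.
  exists (~` G2); first exact: open_closedC.
  apply/seteqP; split => x [Ax ox]; split => //.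
    by move=> o2; rewrite -[False]/(set0 x) -A12.
  by have [//|/ox] := AO _ Ax.
rewrite -[False]/(set0 y) -A12; split => //; by rewrite AE.
Qed.

(** An ultrafilter that contains no bounded disc converges to infinity. Otherwise the compactness of
    a real segment provides limits of the real and imaginary parts. *)
Lemma sphere_compact : compact [set: sphere].
Proof.
rewrite compact_ultra => F FU _.
have [[M FM]|nM] :=
  pselect (exists M : R, F [set x | exists2 w : C, x = Some w & cabs w <= M]);
  last first.
  exists None; split=> //= A [A0 [M MA]].
  have [//|FnM] := in_ultra_setVsetC [set x | exists2 w : C, x = Some w & cabs w <= M] FU.
    by move=> FM; case: nM; exists M.
  apply: filterS FnM => -[w /= nw|//]; apply: MA; rewrite ltNge; apply/negP => wM.
  by apply: nw; exists w.
have lim (f : C -> R) : (forall w, `|f w| <= cabs w) ->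
    exists a : R, forall e : R, 0 < e ->
      F [set x | exists2 w : C, x = Some w & `|f w - a| < e].
  move=> fle; pose g (x : sphere) := if x is Some w then f w else 0.
  have gF : (g @ F) `[- M, M]%classic.
    rewrite /nbhs/=; apply: filterS FM => _ [w -> wM] /=.
    rewrite in_itv/= -ler_norml; exact: le_trans (fle w) wM.
  have [a [_ clF]] := @segment_compact R (- M) M (g @ F) _ gF.
  exists a => e e0.
  set B := [set x | _].
  have [//|FnB] := in_ultra_setVsetC B FU.
  have gB : (g @ F) (g @` (~` B `&` [set x | exists2 w : C, x = Some w & cabs w <= M])).
    rewrite /nbhs/=; apply: filterS (filterI FnB FM) => x nx /=; by exists x.
  have := clF _ (ball a e) gB (nbhsx_ballx a e e0).
  move=> [r [[x [nBx [w xw _]] <-]]]; rewrite xw /= => aw.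
  by exfalso; apply: nBx; exists w => //; rewrite distrC.
have [a Ha] := lim (@complex.Re R) (@cabs_Re R).
have [b Hb] := lim (@complex.Im R) (@cabs_Im R).
exists (Some (a +i* b)%C); split=> // A /nbhs_SomeP[r r0 rA].
have r20 : 0 < r / 2 by rewrite divr_gt0.
apply: filterS (filterI (Ha _ r20) (Hb _ r20)) => _ [[w -> wa] [v [<-] vb]].
apply: rA; rewrite (le_lt_trans (cabs_ReIm _))//.
by case: w wa vb => u1 u2 /= wa vb; lra.
Qed.

Lemma sphere_hausdorff : hausdorff_space sphere.
Proof.
move=> x y cxy; apply: contrapT => xy.
suff [A [B [nA nB AB]]] : exists A B : set sphere, [/\ nbhs x A, nbhs y B & A `&` B = set0].
  by have [z] := cxy _ _ nA nB; rewrite AB.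
clear cxy; wlog : x y xy / exists z, x = Some z.
  move=> W; case: x xy => [z|] xy; first by apply: W => //; exists z.
  case: y xy => [z|//] xy; have [||A [B [nA nB AB]]] := W (Some z) None.
  - by [].
  - by exists z.
  - by exists B, A; split => //; rewrite setIC.
case=> z xz; subst x; case: y xy => [w|] xy.
  have zw : 0 < cabs (z - w) / 2.
    by rewrite divr_gt0// cabs_gt0 subr_eq0; apply/eqP => zw; apply: xy; rewrite zw.
  exists [set x | exists2 v : C, x = Some v & cabs (v - z) < cabs (z - w) / 2],
         [set x | exists2 v : C, x = Some v & cabs (v - w) < cabs (z - w) / 2]; split.
  - by apply/nbhs_SomeP; exists (cabs (z - w) / 2) => // v vz; exists v.
  - by apply/nbhs_SomeP; exists (cabs (z - w) / 2) => // v vz; exists v.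
  - apply/seteqP; split => // _ [[v -> vz] [_ [<-] vw]]/=.
    by have := cabs_dist_trans v z w; rewrite (cabs_distC z v); lra.
exists [set x | exists2 v : C, x = Some v & cabs (v - z) < 1],
  [set x | forall v : C, x = Some v -> cabs z + 1 < cabs v]; split.
- by apply/nbhs_SomeP; exists 1 => // v vz; exists v.
- by apply/nbhs_NoneP; split => //; exists (cabs z + 1) => w zw v [<-].
- apply/seteqP; split => // _ [[v -> vz] /(_ _ erefl)]/=.
  by have := cabsB v z; lra.
Qed.

End SphereTopology.

(** * The maximum modulus principle for rational functions *)

Section MaximumModulus.
Variable R : realType.
Local Notation C := R[i].
Implicit Types (p q N Q : {poly C}) (x y z w : C).

Lemma horner_continuous p : continuous (fun z : C^o => p.[z] : C^o).
Proof.
move=> z; elim/poly_ind: p => [|p c ih].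
  have -> : (fun y : C^o => (0 : {poly C}).[y] : C^o) = cst 0.
    by apply/funext => y; rewrite horner0.
  exact: cst_continuous.
have -> : (fun y : C^o => (p * 'X + c%:P).[y] : C^o) =
    (fun y : C^o => (p.[y] : C^o) * y + (c : C^o)).
  by apply/funext => y; rewrite hornerMXaddC.
exact: cvgD (cvgM ih cvg_id) (cvg_cst _).
Qed.

Lemma nbhs_horner_neq0 p z : p.[z] != 0 -> nbhs (z : C^o) [set w : C | p.[w] != 0].
Proof.
move=> pz; have : nbhs (p.[z] : C^o) [set k : C | k != 0].
  apply/nbhs_cabsP; exists (cabs p.[z]); rewrite ?cabs_gt0// => k kp.
  by apply: contraTneq kp => ->; rewrite sub0r cabsN ltxx.
by move/(@horner_continuous p z).
Qed.

Lemma ratio_continuous N Q z : Q.[z] != 0 ->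
  {for z, continuous (fun y : C^o => N.[y] / Q.[y] : C^o)}.
Proof.
move=> Qz.
exact: cvgM (@horner_continuous N z) (cvgV Qz (@horner_continuous Q z)).
Qed.

Lemma disc_closed z (r : R) :
  closed [set x : sphere R | exists2 w, x = Some w & cabs (w - z) <= r].
Proof.
rewrite -openC openE => -[w|] nw.
  have rw : r < cabs (w - z) by rewrite ltNge; apply/negP => wr; apply: nw; exists w.
  apply/nbhs_SomeP; exists (cabs (w - z) - r); first by rewrite subr_gt0.
  move=> v vw [_ [<-] vz]; have := cabs_dist_trans v w z.
  by rewrite (cabs_distC w v); lra.
apply/nbhs_NoneP; split=> //; exists (cabs z + r) => v zv [_ [<-] vz].
by have := cabsB v z; lra.
Qed.

Lemma disc_compact z (r : R) :
  compact [set x : sphere R | exists2 w, x = Some w & cabs (w - z) <= r].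
Proof. exact: subclosed_compact (@disc_closed z r) (@sphere_compact R) _. Qed.

(* If f = a + (y - z)^m S / Q near z, moving along an m-th root of a / (S z / Q z)
   increases the modulus. *)
Lemma ratio_no_local_max N Q z (r : R) : 0 < r -> Q.[z] != 0 -> N.[z] != 0 ->
  N - (N.[z] / Q.[z]) *: Q != 0 ->
  exists y, [/\ cabs (y - z) < r, Q.[y] != 0 &
                cabs (N.[z] / Q.[z]) < cabs (N.[y] / Q.[y])].
Proof.
move=> r0 Qz Nz; set a := N.[z] / Q.[z]; set T := N - a *: Q => T0.
have a0 : a != 0 by rewrite mulf_neq0 ?invr_eq0.
have [m [S Sz TS]] := multiplicity_XsubC T z.
rewrite T0 /= /root in Sz.
have m0 : (0 < m)%N.
  rewrite lt0n; apply: contra Sz => /eqP m0.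
  have : T.[z] = 0 by rewrite /T hornerD hornerN hornerZ /a mulfVK// subrr.
  by rewrite TS m0 expr0 mulr1 => ->.
pose s := S.[z] / Q.[z].
have s0 : s != 0 by rewrite mulf_neq0 ?invr_eq0.
have [d d0 Hd] : exists2 d : R, 0 < d & forall y, cabs (y - z) < d ->
    Q.[y] != 0 /\ cabs (S.[y] / Q.[y] / s - 1) < 1 / 2.
  apply/nbhs_cabsP; apply: filterI.
    exact: nbhs_horner_neq0.
  have kz : {for z, continuous (fun y : C^o => S.[y] / Q.[y] / s : C^o)}.
    exact: cvgM (@ratio_continuous S Q z Qz) (cvg_cst _).
  have : nbhs (S.[z] / Q.[z] / s : C^o) [set k | cabs (k - 1) < 1 / 2].
    by apply/nbhs_cabsP; exists (1 / 2) => // k; rewrite divff.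
  by move/kz.
pose h := m.-root (a / s); have hm : h ^+ m = a / s by rewrite rootCK.
pose t := Num.min d r / (1 + cabs h).
have h1 : 0 < 1 + cabs h by rewrite ltr_wpDr ?cabs_ge0.
have t0 : 0 < t by rewrite divr_gt0// lt_min d0.
have th : t * cabs h < Num.min d r.
  rewrite /t mulrAC ltr_pdivrMr// ltr_pM2l ?lt_min ?d0//; lra.
pose y := z + t%:C%C * h.
have yz : cabs (y - z) < Num.min d r.
  by rewrite /y addrAC subrr add0r cabsM cabsr ger0_norm ?ltW.
move: (yz); rewrite lt_min => /andP[yd yr].
have [Qy ky] := Hd _ yd.
exists y; split=> //.
set k := S.[y] / Q.[y] / s in ky.
(* The main term gains [t ^+ m], and the error term takes back less than half of it because [k] is
   within 1/2 of 1. *)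
have -> : N.[y] / Q.[y] = a * ((1 + t ^+ m)%:C%C + (t ^+ m)%:C%C * (k - 1)).
  have -> : N = T + a *: Q by rewrite subrK.
  rewrite TS hornerD hornerZ hornerM horner_exp hornerXsubC.
  have -> : y - z = t%:C%C * h by rewrite /y addrAC subrr add0r.
  rewrite exprMn hm -rmorphXn/= rmorphD/= /k.
  by field; rewrite Qy s0.
rewrite [X in _ < X]cabsM ltr_pMr ?cabs_gt0//.
have tm : 0 < t ^+ m by rewrite exprn_gt0.
have h2 := cabsB (1 + t ^+ m)%:C%C (- ((t ^+ m)%:C%C * (k - 1))).
rewrite opprK cabsN cabsM !cabsr !ger0_norm ?addr_ge0 ?(ltW tm)// in h2.
apply: lt_le_trans h2.
have : t ^+ m * cabs (k - 1) < t ^+ m * (1 / 2) by rewrite ltr_pM2l.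
lra.
Qed.

(** A maximum above [B] on the compact disc would be attained in the interior. There
    [ratio_no_local_max] forbids it unless the ratio is constant, and a constant ratio would exceed
    [B] on the circle too. *)
Lemma maximum_modulus N Q z (r B : R) : 0 <= r ->
  (forall y, cabs (y - z) <= r -> Q.[y] != 0) ->
  (forall y, cabs (y - z) = r -> cabs (N.[y] / Q.[y]) <= B) ->
  forall y, cabs (y - z) <= r -> cabs (N.[y] / Q.[y]) <= B.
Proof.
move=> r0 Q0 NB.
(* The disc is placed in the sphere, where compactness is known; the value of [f] at infinity is a
   dummy. *)
pose K := [set x : sphere R | exists2 w, x = Some w & cabs (w - z) <= r].
pose f (x : sphere R) := if x is Some w then cabs (N.[w] / Q.[w]) else 0.
have zr : cabs (z + r%:C%C - z) = r by rewrite addrAC subrr add0r cabsr ger0_norm.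
have fcont : {within K, continuous f}.
  apply: continuous_in_subspaceT => x /set_mem[w -> wr].
  have := continuous_comp (@ratio_continuous N Q w (Q0 _ wr)) (@cabs_continuous R _).
  exact.
have [] := @compact_EVT_max _ R f K _ (@disc_compact z r) fcont.
  by exists (Some z), z; rewrite ?subrr ?cabs0.
move=> x /set_mem[w -> wr] wmax y yr.
have {}wmax v : cabs (v - z) <= r -> cabs (N.[v] / Q.[v]) <= cabs (N.[w] / Q.[w]).
  by move=> vr; apply: (wmax (Some v)); apply/mem_set; exists v.
apply: le_trans (wmax _ yr) _; rewrite leNgt; apply/negP => Bw.
have B0 : 0 <= B by rewrite (le_trans _ (NB _ zr)) ?cabs_ge0.
have wr' : cabs (w - z) < r.
  rewrite lt_neqAle wr andbT; apply/eqP => wz.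
  by have := NB _ wz; rewrite leNgt Bw.
have Qw := Q0 _ wr.
have Nw : N.[w] != 0.
  by apply/eqP => Nw; move: Bw; rewrite Nw mul0r cabs0 ltNge B0.
have [T0|T0] := eqVneq (N - (N.[w] / Q.[w]) *: Q) 0.
  have := NB _ zr; rewrite leNgt (lt_le_trans Bw)//.
  move/eqP: T0; rewrite subr_eq0 => /eqP {2}->.
  by rewrite hornerZ mulfK ?Q0 ?zr.
have rw : 0 < r - cabs (w - z) by rewrite subr_gt0.
have [v [vw Qv]] := ratio_no_local_max rw Qw Nw T0.
rewrite ltNge wmax//; have := cabs_dist_trans w v z; lra.
Qed.

(* The maximum principle for the difference quotient (f y - f w) / (y - w). *)
Lemma ratio_lipschitz N Q z (r B : R) : 0 < r ->
  (forall y, cabs (y - z) <= r -> Q.[y] != 0) ->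
  (forall y, cabs (y - z) <= r -> cabs (N.[y] / Q.[y]) <= B) ->
  forall y w, cabs (y - z) <= r / 2 -> cabs (w - z) <= r / 2 ->
  cabs (N.[y] / Q.[y] - N.[w] / Q.[w]) <= 4 * B / r * cabs (y - w).
Proof.
move=> r0 Q0 NB y w yr wr.
have hr : r / 2 <= r by lra.
have Qw : Q.[w] != 0 by apply: Q0; lra.
have Qy : Q.[y] != 0 by apply: Q0; lra.
(* Dividing by ['X - w%:P] presents the difference quotient as a ratio of polynomials that is also
   defined at [w]. *)
have : root (Q.[w] *: N - N.[w] *: Q) w.
  by rewrite /root hornerD hornerN !hornerZ mulrC subrr.
move/factor_theorem => [D DE].
have dq v : Q.[v] != 0 ->
    (v - w) * (D.[v] / (Q.[w] *: Q).[v]) = N.[v] / Q.[v] - N.[w] / Q.[w].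
  move=> Qv; have := congr1 (horner^~ v) DE.
  rewrite /= hornerM hornerXsubC hornerD hornerN !hornerZ => E.
  rewrite mulrCA mulrA -E; field; by rewrite Qv Qw.
have /(_ y) : forall v, cabs (v - z) <= r -> cabs (D.[v] / (Q.[w] *: Q).[v]) <= 4 * B / r.
  apply: maximum_modulus; first exact: ltW.
  - by move=> v vr; rewrite hornerZ mulf_neq0//; exact: Q0.
  - move=> v vr; have Qv : Q.[v] != 0 by apply: Q0; rewrite vr.
    (* On the circle the numerator is at most [2 B] and the denominator at least [r / 2], whence the
       constant [4 B / r]. *)
    have vw : r / 2 <= cabs (v - w).
      by have := cabs_dist_trans w v z; lra.
    have vw0 : 0 < cabs (v - w) by lra.
    rewrite -(ler_pM2l vw0) -cabsM dq//.
    apply: le_trans (cabsBD _ _) _.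
    have h1 := NB v; have h2 := NB w.
    rewrite vr lexx in h1; have {}h1 := h1 isT; have {}h2 := h2 (le_trans wr hr).
    have B0 : 0 <= B by apply: le_trans h2; rewrite cabs_ge0.
    have : (r / 2) * (4 * B / r) <= cabs (v - w) * (4 * B / r).
      by rewrite ler_wpM2r ?divr_ge0 ?mulr_ge0// ltW.
    have -> : (r / 2) * (4 * B / r) = 2 * B by field; rewrite gt_eqF.
    lra.
have yr' : cabs (y - z) <= r by lra.
move=> /(_ yr') Dy.
by rewrite -dq// cabsM mulrC ler_wpM2r ?cabs_ge0.
Qed.

End MaximumModulus.

(** * Normal families *)

Section Normality.
Variable R : realType.
Local Notation C := R[i].
Local Notation sphere := (sphere R).

(** Reduces normality to meeting each tolerance at arbitrarily late indices. The subsequence [phi]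
    is built recursively, its term of rank [j] meeting the tolerance [1 / (j + 1)] on all of [V]. *)
Lemma frequent_iterates_normal (F : sphere -> sphere) (V : set sphere) :
  sopen V ->
  (forall n_ : nat -> nat, exists g : sphere -> sphere,
     forall e : R, 0 < e -> forall N, exists2 k, (N <= k)%N &
       forall y, V y -> sdist (iter (n_ k) F y) (g y) < e) ->
  iterates_normal F V.
Proof.
move=> oV H n_; have [g Hg] := H n_.
have /choice[next Hnext] : forall Nj : nat * nat, exists k, (Nj.1 <= k)%N /\
    forall y, V y -> sdist (iter (n_ k) F y) (g y) < Nj.2.+1%:R^-1.
  move=> [N j]; have [|k Nk Hk] := Hg j.+1%:R^-1 _ N; first by rewrite invr_gt0.
  by exists k.
pose phi := fix phi k := if k is j.+1 then next ((phi j).+1, k) else next (0, 0)%N.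
exists phi; split=> [k|]; first by have [] := Hnext ((phi k).+1, k.+1).
exists g => x Vx; exists V; split => // e e0.
have [N Ne] : exists N : nat, N.+1%:R^-1 < e.
  exists (Num.bound e^-1); rewrite -[e]invrK ltf_pV2 ?posrE ?invr_gt0// invrK.
  by rewrite (lt_trans (archi_boundP _)) ?ltr_nat// invr_ge0 ltW.
exists N => n Nn y Vy; apply: lt_trans Ne.
apply: (@lt_le_trans _ _ n.+1%:R^-1); last by rewrite lef_pV2 ?posrE ?ler_nat.
by case: n Nn => [|n] Nn /=; [have [_] := Hnext (0, 0)%N|have [_] := Hnext ((phi n).+1, n.+1)]; apply.
Qed.

(** * Arzela-Ascoli on a closed disc *)

Section Ascoli.
Variables (z : C) (r L B : R) (f : nat -> C -> C).
Hypotheses (r0 : 0 <= r) (L0 : 0 <= L).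
Hypothesis f_bounded : forall k y, cabs (y - z) <= r -> cabs (f k y) <= B.
Hypothesis f_lipschitz : forall k y w, cabs (y - z) <= r -> cabs (w - z) <= r ->
  cabs (f k y - f k w) <= L * cabs (y - w).

(** Compactness of the disc gives a cluster point, and along an ultrafilter a cluster point is a
    limit. *)
Lemma ultra_disc_lim (G : set_system nat) (h : nat -> C) (v : C) (t : R) :
  UltraFilter G -> (forall k, cabs (h k - v) <= t) ->
  exists2 y, cabs (y - v) <= t & forall e : R, 0 < e -> G [set k | cabs (h k - y) < e].
Proof.
move=> GU hv.
pose hs k : sphere := Some (h k).
have hG : (hs @ G) [set x : sphere | exists2 w, x = Some w & cabs (w - v) <= t].
  by rewrite /nbhs/=; apply: filterS filterT => k _ /=; exists (h k).
have [_ [[y -> yv] clG]] := @disc_compact R v t (hs @ G) _ hG.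
exists y => // e e0.
have [//|Gn] := in_ultra_setVsetC [set k | cabs (h k - y) < e] GU.
have hGn : (hs @ G) (hs @` ~` [set k | cabs (h k - y) < e]).
  by rewrite /nbhs/=; apply: filterS Gn => k nk /=; exists k.
have ny : nbhs (Some y : sphere) [set x : sphere | exists2 w, x = Some w & cabs (w - y) < e].
  by apply/nbhs_SomeP; exists e => // w wy; exists w.
by have [_ [[k nk <-] [w [<-] wy]]] := clG _ _ hGn ny.
Qed.

(* Pointwise limits along a free ultrafilter on nat replace the diagonal extraction. *)
Lemma ascoli : exists g : C -> C, forall e : R, 0 < e -> forall N, exists2 k, (N <= k)%N &
  forall y, cabs (y - z) <= r -> cabs (f k y - g y) < e.
Proof.
have [G [GU ooG]] := ultraFilterLemma eventually_filter.
have /choice[g Hg] : forall y, exists v, cabs (y - z) <= r ->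
    forall e : R, 0 < e -> G [set k | cabs (f k y - v) < e].
  move=> y; have [yr|ny] := boolP (cabs (y - z) <= r); last by exists 0.
  have [k|v _ Hv] := @ultra_disc_lim G (f^~ y) 0 B GU.
    by rewrite subr0; exact: f_bounded.
  by exists v.
have g_lipschitz y w : cabs (y - z) <= r -> cabs (w - z) <= r ->
    cabs (g y - g w) <= L * cabs (y - w).
  move=> yr wr; apply/ler_addgt0Pr => e e0.
  have e2 : 0 < e / 2 by rewrite divr_gt0.
  have [k [ky kw]] := filter_ex (filterI (Hg _ yr _ e2) (Hg _ wr _ e2)).
  have := f_lipschitz k yr wr; have := cabs_dist_trans (f k y) (g y) (g w).
  have := cabs_dist_trans (f k w) (f k y) (g w).
  by move: ky kw; rewrite /= (cabs_distC (g y) (f k y)); lra.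
exists g => e e0 N; apply: contrapT => Hn.
(* If uniform convergence fails, each late index [k] has a bad point [y k]; early indices receive
   the centre as a default. *)
have /choice[y Hy] : forall k, exists y, cabs (y - z) <= r /\
    ((N <= k)%N -> e <= cabs (f k y - g y)).
  move=> k; have [Nk|] := boolP (N <= k)%N; last first.
    by move=> _; exists z; rewrite subrr cabs0.
  apply: contrapT => nk; apply: Hn; exists k => // y yr.
  by rewrite ltNge; apply/negP => ey; apply: nk; exists y.
have [ys ysr Hys] := @ultra_disc_lim G y z r GU (fun k => (Hy k).1).
(* Close to the limit [ys] of the bad points, the two Lipschitz errors and the pointwise error at
   [ys] are each at most [e / 4]. The [+ 1] keeps the divisor positive when [L = 0]. *)
have L1 : 0 < 4 * (L + 1) by rewrite mulr_gt0// ltr_wpDl.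
have d0 : 0 < e / (4 * (L + 1)) by rewrite divr_gt0.
have e4 : 0 < e / 4 by rewrite divr_gt0.
have GN : G [set k | (N <= k)%N] by apply: ooG; exists N.
have [k [[/= k1 k2] k3]] := filter_ex (filterI (filterI (Hys _ d0) (Hg _ ysr _ e4)) GN).
have [ykr /(_ k3)] := Hy k; apply/negP; rewrite -ltNge.
have l1 := f_lipschitz k ykr ysr; have l2 := g_lipschitz _ _ ysr ykr.
have t1 := cabs_dist_trans (f k ys) (f k (y k)) (g (y k)).
have t2 := cabs_dist_trans (g ys) (f k ys) (g (y k)).
rewrite (cabs_distC ys) in l2.
have : L * cabs (y k - ys) <= e / 4.
  move: k1; rewrite ltr_pdivlMr// => k1; have := cabs_ge0 (y k - ys); nra.
lra.
Qed.

End Ascoli.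

End Normality.

(** * Algebra of St_M *)

Section Multiplicity.
Variable K : numFieldType.
Implicit Types (p : {poly K}) (z : K).

Lemma mup_factor p z : p != 0 ->
  exists2 q, ~~ root q z & p = q * ('X - z%:P) ^+ mup z p.
Proof.
move=> p0; have [m [q qz pE]] := multiplicity_XsubC p z.
rewrite p0 /= in qz; exists q => //.
suff -> : mup z p = m by [].
by rewrite pE mupMr// mup_XsubCX eqxx.
Qed.

Lemma mup_eq1 p z : p.[z] = 0 -> p^`().[z] != 0 -> mup z p = 1%N.
Proof.
move=> pz dpz.
have p0 : p != 0 by apply: contraNneq dpz => ->; rewrite deriv0 horner0.
have [q qz] := mup_factor z p0; case: (mup z p) => [|[//|m]] pE.
  by move: qz; rewrite /root -[q]mulr1 -[1]/(('X - z%:P) ^+ 0) -pE pz eqxx.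
move: dpz; rewrite pE exprSr mulrA derivM derivXsubC mulr1 exprSr mulrA.
by rewrite !hornerE/= subrr !mulr0 addr0 eqxx.
Qed.

(** Once the power of ['X - z%:P] is factored out, every exponent other than 2 contradicts one of
    the three hypotheses. *)
Lemma mup_eq2 p z :
  p.[z] = 0 -> p^`().[z] = 0 -> p^`()^`().[z] != 0 -> mup z p = 2%N.
Proof.
move=> pz dpz ddpz.
have p0 : p != 0 by apply: contraNneq ddpz => ->; rewrite !deriv0 horner0.
have [q qz] := mup_factor z p0; case: (mup z p) => [|[|[//|m]]] pE.
- by move: qz; rewrite /root -[q]mulr1 -[1]/(('X - z%:P) ^+ 0) -pE pz eqxx.
- move: qz dpz; rewrite pE derivM derivXsubC mulr1 !hornerE/= subrr mulr0 add0r.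
  by move=> + q0; rewrite /root q0 eqxx.
have dXM (w : {poly K}) : deriv (w * ('X - z%:P)) = deriv w * ('X - z%:P) + w.
  by rewrite derivM derivXsubC mulr1.
move: ddpz; rewrite pE exprSr exprSr !mulrA.
rewrite dXM derivD dXM dXM !hornerD !hornerM hornerXsubC subrr.
by rewrite exprS hornerM hornerXsubC subrr mul0r !(mulr0, addr0) eqxx.
Qed.

End Multiplicity.

Section StirlingAlgebra.
Variables (R : realType) (b c d : R[i]).
Hypotheses (hb : b != 0) (hc : c != 0).
Local Notation C := R[i].
Local Notation F := (rat_eval (stM b c d)).
Let L : {poly C} := c *: 'X + d%:P.
Let P := (stM b c d).1.
Let Q := (stM b c d).2.

Let LE z : L.[z] = c * z + d.
Proof. by rewrite /L !hornerE. Qed.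

Lemma stM_num_horner z :
  P.[z] = c * z * (c * z + d) ^+ 3 + ((c * z + d) ^+ 2 - b * c) ^+ 2.
Proof. by rewrite /P/= !hornerE. Qed.

Lemma stM_den_horner z : Q.[z] = c * (c * z + d) ^+ 3.
Proof. by rewrite /Q/= !hornerE. Qed.

Let sizeL : size L = 2%N.
Proof. by rewrite /L -mul_polyC size_MXaddC polyC_eq0 (negbTE hc)/= size_polyC hc. Qed.

(** In the variable [L] the denominator is a monomial and the numerator has leading coefficient 2
    and a nonzero constant term, so degrees and coprimality can be read off. *)
Let PE : P = (2%:R *: 'X^4 - d *: 'X^3 - (2%:R * (b * c)) *: 'X^2 +
              ((b * c) ^+ 2)%:P) \Po L.
Proof.
rewrite /P /stM /= -/L.
rewrite !(rmorphD, rmorphB, rmorphN)/= !linearZ/= !comp_Xn_poly comp_polyC.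
have -> : c *: 'X = L - d%:P by rewrite /L addrK.
rewrite -!mul_polyC !(rmorphM, rmorphXn, rmorph_nat)/=; ring.
Qed.

Let QE : Q = (c *: 'X^3) \Po L.
Proof. by rewrite /Q /stM /= linearZ/= comp_Xn_poly. Qed.

Let bc0 : b * c != 0. Proof. by rewrite mulf_neq0. Qed.

Let sizeP : size P = 5%N.
Proof.
rewrite PE size_comp_poly2 ?sizeL//.
have two0 : (2%:R : C) != 0 by rewrite pnatr_eq0.
rewrite -!addrA size_addl size_scale// size_polyXn//.
rewrite (leq_ltn_trans (size_polyD _ _))// gtn_max size_polyN.
rewrite (leq_ltn_trans (size_scale_leq _ _)) ?size_polyXn//=.
rewrite (leq_ltn_trans (size_polyD _ _))// gtn_max size_polyN.
rewrite (leq_ltn_trans (size_scale_leq _ _)) ?size_polyXn//=.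
by rewrite (leq_ltn_trans (size_polyC_leq1 _)).
Qed.

Let sizeQ : size Q = 4%N.
Proof. by rewrite QE size_comp_poly2 ?sizeL// size_scale// size_polyXn. Qed.

Lemma stM_rational : is_rational_map (stM b c d).
Proof.
split; first by rewrite -/Q -size_poly_eq0 sizeQ.
rewrite -/P -/Q PE QE; apply: coprimep_comp_poly.
rewrite coprimepZr// coprimep_expr// coprimepX.
rewrite /root !(hornerD, hornerN, hornerZ, hornerXn, hornerC) !expr0n/=.
by rewrite !mulr0 !subr0 add0r expf_neq0.
Qed.

Lemma rdeg_stM : rdeg (stM b c d) = 4%N.
Proof. by rewrite /rdeg -/P -/Q sizeP sizeQ. Qed.

Lemma stM_eval_None : F None = None.
Proof. by have := sizeP; have := sizeQ; rewrite /P /Q/= => -> ->. Qed.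

Lemma stM_eval_pole z : c * z + d = 0 -> F (Some z) = None.
Proof. by move=> z0; rewrite /= -/Q stM_den_horner z0 expr0n mulr0 eqxx. Qed.

Lemma stM_eval_Some z : c * z + d != 0 -> F (Some z) =
  Some (z + ((c * z + d) ^+ 2 - b * c) ^+ 2 / (c * (c * z + d) ^+ 3)).
Proof.
move=> z0; rewrite /= -/Q -/P stM_den_horner stM_num_horner.
rewrite mulf_neq0 ?expf_neq0//; congr Some; field.
by rewrite hc z0.
Qed.

(** Links the closed formula to the definition of the method. With [y = z - M(z)], one has
    [M'(y) = - b c / (c y + d)^2] and [c y + d = ((c z + d)^2 - b c) / (c z + d)]. *)
Lemma stM_stirling z : c * z + d != 0 -> c * (z - moebM b c d z) + d != 0 ->
  F (Some z) = Some (z - moebM b c d z /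
    derive1 (moebM b c d : C^o -> C^o) (z - moebM b c d z)).
Proof.
move=> z0; set y := z - moebM b c d z => y0; rewrite stM_eval_Some//; congr Some.
have dl : is_derive (y : C^o) (1 : C^o) (fun x : C^o => c * x + d : C^o) c.
  have d1 : is_derive (y : C^o) (1 : C^o) (c *: (id : C^o -> C^o)) (c *: (1 : C^o)).
    exact: is_deriveZ.
  have := is_deriveD d1 (is_derive_cst (d : C^o) (y : C^o) (1 : C^o)).
  by move=> H; apply: (is_derive_eq H); rewrite addr0; exact: mulr1.
have -> : derive1 (moebM b c d : C^o -> C^o) y = - (b * c) / (c * y + d) ^+ 2.
  rewrite derive1E (@deriveMl _ _ (fun x : C^o => (c * x + d)^-1)).
    rewrite (@deriveV _ _ (fun x : C^o => c * x + d : C^o))// derive_val.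
    by rewrite -[_ *: _]/(_ * _); field.
  by apply: (@derivableV _ _ (fun x : C^o => c * x + d : C^o)).
have yE : c * y + d = ((c * z + d) ^+ 2 - b * c) / (c * z + d).
  by rewrite /y /moebM; field.
rewrite yE /moebM; move: y0; rewrite yE mulf_eq0 negb_or => /andP[k0 _].
by field; rewrite hb hc z0 k0.
Qed.

Lemma local_degree_pole : local_degree (stM b c d) (Some (- d / c)) = 3%N.
Proof.
rewrite /local_degree /locdeg_fin -/P -/Q stM_den_horner.
have z0 : c * (- d / c) + d = 0 by field.
rewrite z0 expr0n mulr0 eqxx /=.
have -> : Q = (c ^+ 4)%:P * ('X - (- d / c)%:P) ^+ 3.
  have -> : (c ^+ 4)%:P * ('X - (- d / c)%:P) ^+ 3 =
      c%:P * (c%:P * ('X - (- d / c)%:P)) ^+ 3 :> {poly C}.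
    by rewrite !(rmorphM, rmorphXn)/=; ring.
  rewrite mulrBr -polyCM.
  have -> : c * (- d / c) = - d by field.
  by rewrite /Q/= polyCN opprK !mul_polyC.
rewrite mupMr ?mup_XsubCX ?eqxx//.
by rewrite /root hornerC expf_neq0.
Qed.

(** * Local degree at a finite point other than the pole *)

Section FinitePoint.
Variable z : C.
Let l := c * z + d.
Let k := b * c.
Hypothesis l0 : l != 0.
Let T := P - (P.[z] / Q.[z]) *: Q.

Let Qz : Q.[z] != 0.
Proof. by rewrite stM_den_horner mulf_neq0 ?expf_neq0. Qed.

Let Tz : T.[z] = 0.
Proof. by rewrite /T hornerD hornerN hornerZ mulfVK// subrr. Qed.

Let v := P.[z] / Q.[z].
Let Tw : {poly C} := 2%:R *: 'X^4 - d *: 'X^3 - (2%:R * k) *: 'X^2 +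
  (k ^+ 2)%:P - v *: (c *: 'X^3).

Let TE : T = Tw \Po L.
Proof. by rewrite /T -/v {1}PE {1}QE -comp_polyZ -comp_polyB. Qed.

Let vE : v = (c * z * l ^+ 3 + (l ^+ 2 - k) ^+ 2) / (c * l ^+ 3).
Proof. by rewrite /v stM_num_horner stM_den_horner. Qed.

Let dL : deriv L = c%:P.
Proof. by rewrite derivD derivZ derivX derivC addr0 alg_polyC. Qed.

Let zE : c * z = l - d. Proof. by rewrite /l addrK. Qed.

(** The quartic in [l] is the equation of the finite critical points away from the pole. *)
Let dTz : T^`().[z] = c * (2%:R * l ^+ 4 + 2%:R * k * l ^+ 2 - 3%:R * k ^+ 2) / l.
Proof.
rewrite TE deriv_comp dL hornerM horner_comp hornerC LE -/l /Tw.
rewrite !(derivD, derivN, derivZ, derivXn, derivC).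
rewrite !(hornerD, hornerN, hornerZ, hornerMn, hornerXn, hornerC) vE zE /=.
by field; rewrite hc l0.
Qed.

Let ddTz : T^`()^`().[z] =
  c ^+ 2 * (12%:R * l ^+ 4 + 8%:R * k * l ^+ 2 - 6%:R * k ^+ 2) / l ^+ 2.
Proof.
rewrite TE deriv_comp dL derivM derivC mulr0 addr0 deriv_comp dL.
rewrite !hornerM horner_comp !hornerC LE -/l /Tw.
rewrite !(derivD, derivN, derivZ, derivMn, derivXn, derivC).
rewrite !(hornerD, hornerN, hornerZ, hornerMn, hornerXn, hornerC) vE zE /=.
by field; rewrite hc l0.
Qed.

Lemma local_degree_regular :
  2%:R * l ^+ 4 + 2%:R * k * l ^+ 2 - 3%:R * k ^+ 2 != 0 ->
  local_degree (stM b c d) (Some z) = 1%N.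
Proof.
move=> nc; rewrite /local_degree /locdeg_fin -/P -/Q Qz; apply: mup_eq1 => //.
by rewrite -/T dTz !mulf_neq0 ?invr_eq0.
Qed.

(** The critical point is simple: if the second derivative vanished too, eliminating [l ^+ 4] would
    give [l ^+ 2 = 3 k], and the quartic would equal [21 k ^+ 2], which is nonzero. *)
Lemma local_degree_critical :
  2%:R * l ^+ 4 + 2%:R * k * l ^+ 2 - 3%:R * k ^+ 2 = 0 ->
  local_degree (stM b c d) (Some z) = 2%N.
Proof.
move=> cr; rewrite /local_degree /locdeg_fin -/P -/Q Qz; apply: mup_eq2 => //.
  by rewrite -/T dTz cr mulr0 mul0r.
rewrite -/T ddTz !mulf_neq0 ?invr_eq0 ?expf_neq0//; apply/eqP => cr2.
have h : 4%:R * k * (3%:R * k - l ^+ 2) = 0.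
  rewrite -[LHS]subr0 -[X in _ - X]cr2.
  have -> : 12%:R * l ^+ 4 = 6%:R * (3%:R * k ^+ 2 - 2%:R * k * l ^+ 2).
    by apply/eqP; rewrite -subr_eq0 -[X in _ == X](mulr0 6%:R) -cr; apply/eqP; ring.
  ring.
have k0 : k != 0 := bc0.
move/eqP: h; rewrite mulf_eq0 => /orP[|].
  by rewrite mulf_eq0 pnatr_eq0 (negbTE k0).
rewrite subr_eq0 => /eqP h.
have l4 : l ^+ 4 = (3%:R * k) ^+ 2 by rewrite h -exprM.
move: cr; rewrite l4 -h => /eqP.
have -> : 2%:R * (3%:R * k) ^+ 2 + 2%:R * k * (3%:R * k) - 3%:R * k ^+ 2 = 21%:R * k ^+ 2.
  by ring.
by rewrite mulf_eq0 pnatr_eq0 expf_eq0 (negbTE k0).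
Qed.

End FinitePoint.

(** The denominator has degree 3, one less than the degree of the map, so its reversal at length 4
    has a simple zero at 0. *)
Lemma local_degree_infty : local_degree (stM b c d) None = 1%N.
Proof.
rewrite /local_degree /locdeg_fin rdeg_stM -/P -/Q.
have Q4 : Q`_4 = 0 by rewrite nth_default// sizeQ.
have Q3 : Q`_3 != 0.
  have : lead_coef Q != 0 by rewrite lead_coef_eq0 -size_poly_eq0 sizeQ.
  by rewrite /lead_coef sizeQ.
have c0 : (homrev 4 Q)`_0 = 0 by rewrite coef_poly /= subn0.
have c1 : (homrev 4 Q)`_1 != 0 by rewrite coef_poly.
rewrite horner_coef0 c0 eqxx /=; apply: mup_eq1; first by rewrite horner_coef0.
by rewrite horner_coef0 coef_deriv.
Qed.

(** The triple pole counts for 2. The quartic is quadratic in [l ^+ 2], with roots [k (-1 + r) / 2]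
    and [k (-1 - r) / 2] where [r ^+ 2 = 7]; their four distinct square roots count for 1 each. *)
Lemma stM_num_crit_points : num_crit_points (stM b c d) 6.
Proof.
pose k := b * c.
pose r := sqrtc (7%:R : C); have rr : r ^+ 2 = 7%:R by rewrite sqr_sqrtc.
pose a1 := k * (-1 + r) / 2%:R; pose a2 := k * (-1 - r) / 2%:R.
pose l1 := sqrtc a1; pose l2 := sqrtc a2.
have l1E : l1 ^+ 2 = a1 by rewrite sqr_sqrtc.
have l2E : l2 ^+ 2 = a2 by rewrite sqr_sqrtc.
have two0 : (2%:R : C) != 0 by rewrite pnatr_eq0.
have fact l : 2%:R * l ^+ 4 + 2%:R * k * l ^+ 2 - 3%:R * k ^+ 2 =
    2%:R * ((l - l1) * (l + l1) * ((l - l2) * (l + l2))).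
  rewrite -!subr_sqr l1E l2E /a1 /a2.
  have -> : 2%:R * ((l ^+ 2 - k * (-1 + r) / 2%:R) * (l ^+ 2 - k * (-1 - r) / 2%:R)) =
    2%:R * l ^+ 4 + 2%:R * k * l ^+ 2 + k ^+ 2 * (1 - r ^+ 2) / 2%:R by field.
  by rewrite rr; field.
have r0 : r != 0 by rewrite -sqrf_eq0 rr pnatr_eq0.
have a10 : a1 != 0.
  rewrite !mulf_neq0 ?invr_eq0//; apply/eqP => h.
  have : r = 1 by apply/eqP; rewrite -subr_eq0 addrC h.
  by move/(congr1 (fun x => x ^+ 2)); rewrite rr expr1n => /eqP; rewrite pnatr_eq1.
have a20 : a2 != 0.
  rewrite !mulf_neq0 ?invr_eq0//; apply/eqP => h.
  have : r = -1 by apply/eqP; rewrite -subr_eq0 -oppr_eq0 opprB h.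
  by move/(congr1 (fun x => x ^+ 2)); rewrite rr sqrrN expr1n => /eqP; rewrite pnatr_eq1.
have a12 : a1 != a2.
  rewrite -subr_eq0.
  have -> : a1 - a2 = k * r by rewrite /a1 /a2; field.
  by rewrite mulf_neq0.
have l10 : l1 != 0 by rewrite -sqrf_eq0 l1E.
have l20 : l2 != 0 by rewrite -sqrf_eq0 l2E.
have self (l : C) : l != 0 -> l != - l.
  by move=> l0; rewrite -subr_eq0 opprK -mulr2n -mulr_natl mulf_neq0.
have sep (u v : C) : u ^+ 2 = a1 -> v ^+ 2 = a2 -> u != v.
  by move=> ua va; apply: contraNneq a12 => uv; rewrite -ua -va uv.
pose ls := [:: 0; l1; - l1; l2; - l2].
have uls : uniq ls.
  rewrite /= !inE !negb_or !andbT [0 == _]eq_sym [0 == - l1]eq_sym [0 == l2]eq_sym [0 == - l2]eq_sym !oppr_eq0.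
  rewrite l10 l20 !self//=.
  by rewrite !sep// sqrrN.
pose z_ l : sphere R := Some ((l - d) / c).
have z_inj : injective z_.
  move=> u v [] /(congr1 (fun x => x * c + d)); by rewrite !mulfVK// !subrK.
have z_c l : c * ((l - d) / c) + d = l by field.
have crit l : l \in behead ls -> local_degree (stM b c d) (z_ l) = 2%N.
  move=> ll; have l0 : l != 0.
    by move: uls => /= /andP[+ _]; apply: contraNneq => <-.
  apply: local_degree_critical; rewrite z_c// -/k fact.
  by move: ll; rewrite !inE => /or4P[] /eqP ->; rewrite ?subrr ?addNr ?(mul0r, mulr0).
exists (map z_ ls); split; first by rewrite map_inj_uniq.
  case=> [z|_]; last exact: local_degree_infty.
  have -> : Some z = z_ (c * z + d) by rewrite /z_ addrK mulrC mulKf.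
  rewrite mem_map// !inE !negb_or => /and5P[l0 n1 n2 n3 n4].
  apply: local_degree_regular; rewrite z_c// -/k fact.
  by rewrite !mulf_neq0// ?subr_eq0 ?addr_eq0.
have p3 : local_degree (stM b c d) (z_ 0) = 3%N.
  by rewrite /z_ sub0r local_degree_pole.
rewrite /ls /= !big_cons big_nil p3 !crit// !inE eqxx ?orbT//.
Qed.

(** Near 0 the quotient [G(h) / h] is the ratio [N / D], which is continuous there, so the
    derivative is its value [c^4 / (2 c^4)]. *)
Lemma stM_multiplier_infty :
  is_derive (0 : C^o) (1 : C^o) (chart_infty F : C^o -> C^o) (1 / 2).
Proof.
pose M : {poly C} := c%:P + d *: 'X.
pose N : {poly C} := c *: M ^+ 3.
pose D : {poly C} := N + (M ^+ 2 - (b * c) *: 'X ^+ 2) ^+ 2.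
have ME h : M.[h] = c + d * h by rewrite /M hornerD hornerC hornerZ hornerX.
have NE h : N.[h] = c * (c + d * h) ^+ 3 by rewrite /N hornerZ horner_exp ME.
have DE h : D.[h] = c * (c + d * h) ^+ 3 + ((c + d * h) ^+ 2 - b * c * h ^+ 2) ^+ 2.
  by rewrite /D hornerD NE horner_exp hornerD hornerN hornerZ !horner_exp ME hornerX.
have DE0 : D.[0] = 2%:R * c ^+ 4 by rewrite DE; ring.
have D0 : D.[0] != 0 by rewrite DE0 mulf_neq0 ?expf_neq0// pnatr_eq0.
have ND0 : N.[0] / D.[0] = 1 / 2.
  by rewrite DE0 NE; field; rewrite hc.
have lim : (fun h : C^o => h^-1 *: (((chart_infty F : C^o -> C^o) \o shift 0) (h *: 1) -
    (chart_infty F : C^o -> C^o) 0)) @ (0 : C^o)^' --> (1 / 2 : C^o).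
  rewrite -ND0 => A /(@ratio_continuous _ N D 0 D0) nA.
  have nM : nbhs (0 : C^o) [set h | c + d * h != 0].
    have -> : [set h : C^o | c + d * h != 0] = [set h : C^o | M.[h] != 0].
      by apply/funext => h /=; rewrite ME.
    by apply: nbhs_horner_neq0; rewrite ME mulr0 addr0.
  have {}nA : nbhs (0 : C^o) [set y | A (N.[y] / D.[y])] := nA.
  suff : nbhs (0 : C^o) [set h : C^o | h != 0 ->
    A (h^-1 *: (chart_infty F (h *: 1 + 0) - chart_infty F 0))] by [].
  move/nbhs_cabsP: nA => [r1 r10 r1A]; move/nbhs_cabsP: nM => [r2 r20 r2M].
  apply/nbhs_cabsP; exists (Num.min r1 r2); first by rewrite lt_min r10.
  move=> h; rewrite lt_min => /andP[/r1A Ah /r2M/= Mh] h0.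
  suff -> : h^-1 *: (chart_infty F (h *: 1 + 0) - chart_infty F 0) = N.[h] / D.[h] by [].
  have -> : h *: 1 + 0 = h :> C by rewrite addr0 [_ *: _]mulr1.
  rewrite /chart_infty (negbTE h0) eqxx stM_eval_None subr0.
  have cE : c * h^-1 + d = (c + d * h) / h by field.
  rewrite stM_eval_Some cE ?mulf_neq0 ?invr_eq0//.
  set W := h^-1 + _.
  have WE : h * W = D.[h] / N.[h] by rewrite /W DE NE; field; rewrite hc h0 Mh.
  by rewrite -[LHS]/(_ * _) -invfM WE invf_div.
apply: DeriveDef; first by apply: cvgP lim.
exact: cvg_lim lim.
Qed.

Lemma stM_attracting_infty : attracting_fixed_infty F.
Proof.
split; first exact: stM_eval_None.
exists (1 / 2); split; first exact: stM_multiplier_infty.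
by rewrite cabsf_div cabs1 cabs_nat; lra.
Qed.

End StirlingAlgebra.

(** * Dynamics of St_M near infinity *)

Section ConnectedSets.
Variable R : realType.
Local Notation C := R[i].
Local Notation sphere := (sphere R).

Lemma star_connected (T : topologicalType) (S : set T) (p : T) :
  (forall x, S x -> exists A, [/\ connected A, A `<=` S, A p & A x]) -> connected S.
Proof.
move=> H; suff <- : connected_component S p = S by exact: component_connected.
apply/seteqP; split=> [|x Sx]; first exact: connected_component_sub.
by have [A [cA AS Ap Ax]] := H x Sx; exists A.
Qed.

Lemma line_continuous (a v : C) :
  continuous (fun t : R => Some (a + t%:C%C * v) : sphere).
Proof.
move=> t A /nbhs_SomeP[r r0 rA].
have v1 : 0 < 1 + cabs v by rewrite ltr_wpDr ?cabs_ge0.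
apply/nbhs_ballP; exists (r / (1 + cabs v)); first by rewrite /= divr_gt0.
move=> u; rewrite /ball/= ltr_pdivlMr// => tu; apply: rA.
have -> : a + u%:C%C * v - (a + t%:C%C * v) = (u - t)%:C%C * v.
  by rewrite rmorphB/=; ring.
rewrite cabsM cabsr distrC; have := cabs_ge0 v; have := normr_ge0 (t - u); nra.
Qed.

Lemma line_connected (a v : C) (D : set R) : is_interval D ->
  connected ((fun t : R => Some (a + t%:C%C * v) : sphere) @` D).
Proof.
move=> iD; apply: connected_continuous_connected; first exact/connected_intervalP.
by apply: continuous_subspaceT; exact: line_continuous.
Qed.

Definition segment (z w : C) : set sphere :=
  (fun t : R => Some (z + t%:C%C * (w - z)) : sphere) @` [set t | 0 <= t <= 1].

Lemma segment_connected z w : connected (segment z w).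
Proof.
apply: line_connected => x y /= /andP[x0 _] /andP[_ y1] t /andP[xt ty].
by rewrite (le_trans x0)// (le_trans ty).
Qed.

Lemma segment_left z w : segment z w (Some z).
Proof. by exists 0; rewrite /= ?lexx ?ler01// mul0r addr0. Qed.

Lemma segment_right z w : segment z w (Some w).
Proof. by exists 1; rewrite /= ?lexx ?ler01// mul1r addrC subrK. Qed.

Lemma disc_connected (z : C) (r : R) :
  connected [set x : sphere | exists2 w, x = Some w & cabs (w - z) < r].
Proof.
apply: (@star_connected _ _ (Some z : sphere)) => _ [w -> wr].
exists (segment z w); split; first exact: segment_connected.
- move=> _ [t /= /andP[t0 t1] <-].
  exists (z + t%:C%C * (w - z)) => //.
  rewrite addrAC subrr add0r cabsM cabsr ger0_norm//.
  by have := cabs_ge0 (w - z); nra.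
- exact: segment_left.
- exact: segment_right.
Qed.

End ConnectedSets.

(** The modulus of [p.[x]] is that of the leading coefficient times the product of the distances
    from [x] to the roots, so these distances cannot all be at least [e]. *)
Lemma root_near (R : realType) (p : {poly R[i]}) (x : R[i]) (e : R) : 0 < e -> p != 0 ->
  cabs p.[x] < cabs (lead_coef p) * e ^+ (size p).-1 ->
  exists2 y, root p y & cabs (y - x) < e.
Proof.
move=> e0 p0 px; apply: contrapT => H.
have [rs pE] := closed_field_poly_normal p.
have lc0 : lead_coef p != 0 by rewrite lead_coef_eq0.
have szp : (size p).-1 = size rs.
  by rewrite pE size_scale// size_prod_XsubC.
have far y : y \in rs -> e <= cabs (x - y).
  move=> yrs; rewrite leNgt; apply/negP => yx; apply: H.
  by exists y; rewrite 1?cabs_distC// pE rootZ// root_prod_XsubC.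
move: px; apply/negP; rewrite -leNgt pE hornerZ cabsM lead_coefZ.
rewrite (eqP (monic_prod_XsubC _ _ _)) mulr1 ler_wpM2l ?cabs_ge0//.
rewrite -pE szp horner_prod; elim: rs far {pE szp} => [|y rs ih] far.
  by rewrite big_nil cabs1 expr0.
rewrite big_cons cabsM /= exprS hornerXsubC.
apply: ler_pM; [exact: ltW|exact: exprn_ge0 (ltW e0)|by rewrite far// mem_head|].
by apply: ih => v vrs; rewrite far// inE vrs orbT.
Qed.

(** * The normal form of St_M, its openness and continuity, and a connected set attracted to
    infinity *)

Section Dynamics.
Variables (R : realType) (b c d : R[i]).
Hypotheses (hb : b != 0) (hc : c != 0).
Local Notation C := R[i].
Local Notation sphere := (sphere R).
Local Notation F := (rat_eval (stM b c d)).

Definition stM_scale := sqrtc (b * c).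
Local Notation sq := stM_scale.
Definition stM_coord (z : C) : C := (c * z + d) / sq.
Definition stM_coordV (w : C) : C := (sq * w - d) / c.
Local Notation ell := stM_coord.
Local Notation ellV := stM_coordV.

Definition normal_form (w : C) : C := 2%:R * w - 2%:R / w + (w ^+ 3)^-1.

Lemma stM_scale_sqr : sq ^+ 2 = b * c. Proof. exact: sqr_sqrtc. Qed.

Lemma stM_scale_neq0 : sq != 0. Proof. by rewrite -sqrf_eq0 stM_scale_sqr mulf_neq0. Qed.

Lemma ellK : cancel ell ellV.
Proof. by move=> z; rewrite /ell /ellV; field; rewrite hc stM_scale_neq0. Qed.

Lemma ellVK : cancel ellV ell.
Proof. by move=> z; rewrite /ell /ellV; field; rewrite hc stM_scale_neq0. Qed.

Lemma ell_eq0 z : (ell z == 0) = (c * z + d == 0).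
Proof. by rewrite mulf_eq0 invr_eq0 (negbTE stM_scale_neq0) orbF. Qed.

Lemma stM_eval_ell z : ell z != 0 -> F (Some z) = Some (ellV (normal_form (ell z))).
Proof.
move=> z0; have l0 : c * z + d != 0 by rewrite -ell_eq0.
rewrite stM_eval_Some//; congr Some; rewrite /normal_form /ellV /ell -stM_scale_sqr.
by field; rewrite hc l0 stM_scale_neq0.
Qed.

Lemma stM_eval_ell0 z : ell z = 0 -> F (Some z) = None.
Proof. by move/eqP; rewrite ell_eq0 => /eqP/stM_eval_pole. Qed.

Lemma stM_eval_eq_None x : F x = None -> x = None \/ exists2 z, x = Some z & ell z = 0.
Proof.
case: x => [z|]; last by left.
have [z0 _|z0] := eqVneq (ell z) 0; first by right; exists z.
by rewrite stM_eval_ell.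
Qed.

Lemma ellB z w : ell z - ell w = c / sq * (z - w).
Proof. by rewrite /ell; field; rewrite stM_scale_neq0. Qed.

Lemma ell_large (M : R) z :
  (cabs sq * M + cabs d) / cabs c < cabs z -> M < cabs (ell z).
Proof.
have s0 : 0 < cabs sq by rewrite cabs_gt0 stM_scale_neq0.
rewrite /ell cabsf_div ltr_pdivlMr// ltr_pdivrMr ?cabs_gt0// => h.
have := cabsB (c * z) (- d); rewrite opprK cabsN cabsM; lra.
Qed.

Lemma ell_large_inv (K : R) z :
  (cabs c * K + cabs d) / cabs sq < cabs (ell z) -> K < cabs z.
Proof.
have s0 : 0 < cabs sq by rewrite cabs_gt0 stM_scale_neq0.
have c0 : 0 < cabs c by rewrite cabs_gt0.
rewrite /ell cabsf_div ltr_pM2r ?invr_gt0// => h.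
rewrite -(ltr_pM2l c0); have := cabsD (c * z) d; rewrite cabsM; lra.
Qed.

(** The coordinate [ell] is affine, so neighbourhoods can be measured in it, where the map no longer
    depends on the parameters. *)
Lemma nbhs_None_ell (A : set sphere) : nbhs (None : sphere) A <->
  A None /\ exists M : R, forall z, M < cabs (ell z) -> A (Some z).
Proof.
split=> [/nbhs_NoneP[A0 [M MA]]|[A0 [M MA]]].
  by split=> //; exists ((cabs c * M + cabs d) / cabs sq) => z /ell_large_inv/MA.
apply/nbhs_NoneP; split=> //.
by exists ((cabs sq * M + cabs d) / cabs c) => z /ell_large/MA.
Qed.

Lemma nbhs_Some_ell z (A : set sphere) : nbhs (Some z : sphere) A <->
  exists2 r : R, 0 < r & forall w, cabs (ell w - ell z) < r -> A (Some w).
Proof.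
have q0 : 0 < cabs (c / sq) by rewrite cabs_gt0 mulf_neq0 ?invr_eq0 ?stM_scale_neq0.
split=> [/nbhs_SomeP[r r0 rA]|[r r0 rA]].
  exists (cabs (c / sq) * r); first by rewrite mulr_gt0.
  by move=> w; rewrite ellB cabsM ltr_pM2l// => /rA.
apply/nbhs_SomeP; exists (r / cabs (c / sq)); first by rewrite divr_gt0.
by move=> w; rewrite ltr_pdivlMr// mulrC -cabsM -ellB => /rA.
Qed.

Definition far (M : R) : set sphere :=
  [set x | if x is Some z then M < cabs (ell z) else True].

Definition escaping : set sphere :=
  [set x | if x is Some z then complex.Re (ell z) = 0 \/ 3 < cabs (ell z) else True].

Lemma far_escaping (M : R) x : 3 <= M -> far M x -> escaping x.
Proof. by case: x => [z|//] M3 /= h; right; apply: le_lt_trans h. Qed.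

(** On the imaginary axis the three terms have the same sign, so that nothing cancels. *)
Lemma normal_form_im (y : R) : y != 0 ->
  normal_form (0 +i* y)%C = (0 +i* (2 * y + 2 / y + (y ^+ 3)^-1))%C.
Proof.
move=> y0; set w := (0 +i* y)%C.
have wV : w^-1 = (0 +i* (- y^-1))%C.
  have w0 : w != 0 by rewrite eq_complex /= negb_and y0 orbT.
  apply: (mulfI w0); rewrite divff//; apply/eqP; rewrite eq_complex /=.
  by rewrite !mul0r !mulr0 sub0r mulrN opprK divff// addr0 !eqxx.
rewrite /normal_form -exprVn wV; apply/eqP; rewrite eq_complex /=.
by apply/andP; split; apply/eqP; field.
Qed.

Lemma normal_form_Re w : w != 0 -> complex.Re w = 0 -> complex.Re (normal_form w) = 0.
Proof.
case: w => a y w0 a0; rewrite /= in a0; subst a.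
have y0 : y != 0 by move: w0; apply: contraNneq => ->.
by rewrite normal_form_im.
Qed.

(** On the axis, where [y] is the modulus, this follows from [y + 1/y >= 2]; off the disc of radius
    3, from [2 |w| - 2 / |w| - 1 / |w|^3 >= 2 |w| - 1]. *)
Lemma normal_form_growth w : w != 0 -> complex.Re w = 0 \/ 3 < cabs w ->
  cabs w + 1 <= cabs (normal_form w).
Proof.
move=> w0 [|w3].
  case: w w0 => a y; rewrite /= => + a0; rewrite a0 => w0.
  have y0 : y != 0 by move: w0; apply: contraNneq => ->.
  rewrite normal_form_im// /cabs/= expr0n !add0r !sqrtr_sqr.
  have -> : 2 * y + 2 / y + (y ^+ 3)^-1 = y * (2 + 2 / y ^+ 2 + (y ^+ 2) ^- 2) by field.
  have -> : y ^+ 2 = `|y| ^+ 2 by rewrite real_normK ?num_real.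
  rewrite normrM; have : 0 < `|y| by rewrite normr_gt0.
  move: `|y| => {w0 y0 a0 a} {}y y0; rewrite ger0_norm; last first.
    by rewrite !addr_ge0 ?mulr_ge0 ?invr_ge0 ?exprn_ge0 ?ltW.
  have -> : y * (2 + 2 / y ^+ 2 + y ^+ 2 ^- 2) = 2 * y + 2 * y^-1 + y^-1 ^+ 3.
    by field; rewrite gt_eqF.
  have t0 : 0 < y^-1 by rewrite invr_gt0.
  have yt : y * y^-1 = 1 by rewrite divff// gt_eqF.
  move: y^-1 t0 yt => t t0 yt.
  have t30 : 0 < t ^+ 3 by rewrite exprn_gt0.
  have : 2 <= y + t by have := sqr_ge0 (y - t); nra.
  lra.
have h1 : cabs (2%:R * w) <= cabs (normal_form w) + cabs (2%:R / w) + cabs (w ^+ 3)^-1.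
  have -> : 2%:R * w = normal_form w + 2%:R / w - (w ^+ 3)^-1 by rewrite /normal_form; ring.
  by rewrite (le_trans (cabsBD _ _))// lerD2r cabsD.
move: h1; rewrite cabsM cabsf_div !cabs_nat cabsV cabsX.
move: (cabs w) w3 => a a3.
have a0 : 0 < a by lra.
have t1 : a^-1 <= 1 / 3 by rewrite ler_pdivlMr// mulrC ler_pdivrMr//; lra.
have t0 : 0 < a^-1 by rewrite invr_gt0.
have : (a ^+ 3)^-1 <= 1 / 3.
  rewrite -exprVn; move: a^-1 t0 t1 => t t0 t1.
  by rewrite !exprS expr0; nra.
lra.
Qed.

Lemma escaping_stM x : escaping x -> escaping (F x).
Proof.
case: x => [z|_]; last by rewrite stM_eval_None.
have [z0 _|z0] := eqVneq (ell z) 0; first by rewrite stM_eval_ell0.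
move=> ez; rewrite stM_eval_ell//= ellVK.
have := normal_form_growth z0 ez; case: ez => [Re0 _|z3 h]; [left|by right; lra].
exact: normal_form_Re.
Qed.

Lemma far_stM (M : R) x : escaping x -> far M x -> far (M + 1) (F x).
Proof.
case: x => [z|_ _]; last by rewrite stM_eval_None.
have [z0 _ _|z0] := eqVneq (ell z) 0; first by rewrite stM_eval_ell0.
move=> ez Mz; rewrite stM_eval_ell// /far/= ellVK.
by have := normal_form_growth z0 ez; rewrite /far/= in Mz; lra.
Qed.

Lemma far_iter (M : R) n x : escaping x -> far M x ->
  escaping (iter n F x) /\ far (M + n%:R) (iter n F x).
Proof.
move=> ex fx; elim: n => [|n [en fn]]; first by rewrite addr0.
rewrite iterS; split; first exact: escaping_stM.
by rewrite -natr1 addrA; exact: far_stM.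
Qed.

Lemma escaping_iter_far x : escaping x -> far 3 (iter 5 F x).
Proof.
(* The inequality in [far] is strict, so [-1] is a bound valid at every point; five unit gains raise
   it to 4. *)
move=> ex; have f1 : far (-1) x.
  by case: x {ex} => [z|] //=; rewrite (lt_le_trans _ (cabs_ge0 _))// oppr_lt0.
have [_] := far_iter 5 ex f1; case: (iter 5 F x) => [z|//] /=; lra.
Qed.

Lemma far_open (M : R) : open (far M).
Proof.
rewrite openE => -[z|] /= h; last by apply/nbhs_None_ell; split => //; exists M.
apply/nbhs_Some_ell; exists (cabs (ell z) - M); first by rewrite subr_gt0.
move=> w; have := cabsB (ell z) (ell w); rewrite (cabs_distC (ell z)) /=; lra.
Qed.

Lemma nbhsC_S2 (z : C) (A B D : set C) : (forall w, A w -> B w -> D w) ->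
  nbhs (z : C^o) A -> nbhs (z : C^o) B -> nbhs (z : C^o) D.
Proof. exact: filterS2. Qed.

Lemma stM_continuous : continuous (F : sphere -> sphere).
Proof.
set P := (stM b c d).1; set Q := (stM b c d).2.
have FE w : F (Some w) = if Q.[w] != 0 then Some (P.[w] / Q.[w]) else None by [].
case=> [z|] A.
  have [Qz|Qz] := boolP (Q.[z] != 0).
    rewrite FE Qz => /(@ratio_continuous _ P Q z Qz) nA.
    suff : nbhs (z : C^o) [set w | A (F (Some w))] by [].
    have {}nA : nbhs (z : C^o) [set w | A (Some (P.[w] / Q.[w]))] := nA.
    apply: nbhsC_S2 nA (nbhs_horner_neq0 Qz) => w Aw Qw.
    by rewrite /= -/P -/Q Qw.
  (* At the pole the inverse ratio [Q / P] is continuous with value 0, so [P / Q] is large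
     nearby. *)
  rewrite FE (negbTE Qz) => /nbhs_NoneP[A0 [M MA]].
  have Qz0 : Q.[z] = 0 by apply/eqP; move: Qz; rewrite negbK.
  have Pz : P.[z] != 0.
    rewrite stM_num_horner; move/eqP: Qz0; rewrite stM_den_horner mulf_eq0 (negbTE hc)/=.
    rewrite expf_eq0/= => /eqP ->; rewrite !expr0n/= mulr0 add0r sub0r sqrrN.
    by rewrite expf_neq0// mulf_neq0.
  have M1 : 0 < `|M| + 1 by rewrite ltr_wpDl.
  have nA : nbhs (Q.[z] / P.[z] : C^o) [set k | cabs k < (`|M| + 1)^-1].
    apply/nbhs_cabsP; exists (`|M| + 1)^-1; first by rewrite invr_gt0.
    by move=> k; rewrite Qz0 mul0r subr0.
  move/(@ratio_continuous _ Q P z Pz) : nA => nA.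
  suff : nbhs (z : C^o) [set w | A (F (Some w))] by [].
  have {}nA : nbhs (z : C^o) [set w | cabs (Q.[w] / P.[w]) < (`|M| + 1)^-1] := nA.
  apply: nbhsC_S2 nA (nbhs_horner_neq0 Pz) => w /= Aw Pw.
  rewrite -/P -/Q; have [->|Qw] := eqVneq Q.[w] 0; first by [].
  apply: MA; rewrite (le_lt_trans (ler_norm M))//.
  rewrite -[P.[w] / _]invf_div cabsV.
  have QP : 0 < cabs (Q.[w] / P.[w]) by rewrite cabs_gt0 mulf_neq0 ?invr_eq0.
  suff : `|M| + 1 < (cabs (Q.[w] / P.[w]))^-1 by lra.
  by rewrite -[X in X < _]invrK ltf_pV2 ?posrE ?invr_gt0.
rewrite stM_eval_None// => /nbhs_None_ell[A0 [M MA]]; apply/nbhs_None_ell; split.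
  by rewrite -[_ None]/(A (F None)) stM_eval_None.
exists (Num.max M 3) => z; rewrite gt_max -[_ (Some z)]/(A (F (Some z))) => /andP[Mz z3].
have ez : escaping (Some z) by right.
have := far_stM ez (Mz : far M (Some z)); case: (F (Some z)) => [w|//] /= h.
by apply: MA; lra.
Qed.

Lemma stM_iter_continuous n : continuous (iter n F : sphere -> sphere).
Proof.
elim: n => [|n ih] x; first exact: cvg_id.
by apply: continuous_comp; [exact: ih|exact: stM_continuous].
Qed.

(* The preimages of w solve 2 x^4 - w x^3 - 2 x^2 + 1 = 0 in the coordinate ell,
   whose leading coefficient does not depend on w. *)
Lemma stM_open z (A : set sphere) : ell z != 0 -> nbhs (Some z : sphere) A ->
  nbhs (F (Some z)) (F @` A).
Proof.
move=> z0 /nbhs_Some_ell[r r0 rA]; rewrite stM_eval_ell//.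
set x := ell z in z0 rA *.
have x0 : 0 < cabs x by rewrite cabs_gt0.
(* Since [p.[x] = (normal_form x - w) * x ^+ 3], this radius is exactly the condition [cabs p.[x] <
   2 * r ^+ 4] of [root_near]. *)
apply/nbhs_Some_ell; exists (2 * r ^+ 4 / cabs x ^+ 3).
  by rewrite divr_gt0 ?mulr_gt0 ?exprn_gt0.
move=> v; rewrite ellVK ltr_pdivlMr ?exprn_gt0// => vx.
set w := ell v in vx.
pose p : {poly C} := 2%:R *: 'X^4 + (- w *: 'X^3 + (- 2%:R *: 'X^2 + 1%:P)).
have szr : (size (- w *: 'X^3 + (- 2%:R *: 'X^2 + 1%:P) : {poly C})%R < 5)%N.
  rewrite (leq_ltn_trans (size_polyD _ _))// gtn_max.
  rewrite (leq_ltn_trans (size_scale_leq _ _)) ?size_polyXn//=.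
  rewrite (leq_ltn_trans (size_polyD _ _))// gtn_max.
  rewrite (leq_ltn_trans (size_scale_leq _ _)) ?size_polyXn//=.
  by rewrite (leq_ltn_trans (size_polyC_leq1 _)).
have two0 : (2%:R : C) != 0 by rewrite pnatr_eq0.
have sz2 : size (2%:R *: 'X^4 : {poly C}) = 5%N by rewrite size_scale// size_polyXn.
have szp : size p = 5%N by rewrite size_addl sz2.
have lcp : lead_coef p = 2%:R.
  by rewrite lead_coefDl ?sz2// lead_coefZ lead_coefXn mulr1.
have pE y : p.[y] = 2%:R * y ^+ 4 - w * y ^+ 3 - 2%:R * y ^+ 2 + 1.
  rewrite /p !(hornerD, hornerZ, hornerXn, hornerC); ring.
have p0 : p != 0 by rewrite -size_poly_eq0 szp.
have [|y py yx] := @root_near _ p x r r0 p0.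
  have -> : p.[x] = (normal_form x - w) * x ^+ 3 by rewrite pE /normal_form; field.
  by rewrite cabsM cabsX cabs_distC szp lcp cabs_nat.
have y0 : y != 0.
  apply: contraTneq py => ->; rewrite /root pE !expr0n/= !mulr0 !subr0 add0r.
  exact: oner_neq0.
exists (Some (ellV y)); first by apply: rA; rewrite ellVK.
rewrite stM_eval_ell ellVK//; congr Some; rewrite -[v]ellK -/w; congr ellV.
move: py; rewrite /root pE => /eqP py.
have -> : normal_form y = w + (2%:R * y ^+ 4 - w * y ^+ 3 - 2%:R * y ^+ 2 + 1) / y ^+ 3.
  by rewrite /normal_form; field.
by rewrite py mul0r addr0.
Qed.

(** Each point is joined to infinity by a ray pointing away from the pole [- d / c]. The closure of
    the ray contains infinity, and [cabs (ell _)] is smallest at its origin. *)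
Lemma far_connected (M : R) : 0 <= M -> connected (far M).
Proof.
move=> M0; apply: (@star_connected _ _ (None : sphere)) => -[z|] fz; last first.
  by exists [set None]; split=> //; [exact: connected1|move=> _ ->].
pose ray : set sphere :=
  (fun t : R => Some (- d / c + t%:C%C * (z + d / c)) : sphere) @` [set t | 1 <= t].
have ellray (t : R) : ell (- d / c + t%:C%C * (z + d / c)) = t%:C%C * ell z.
  by rewrite /ell; field; rewrite hc stM_scale_neq0.
have zray : ray (Some z).
  exists 1; first exact: lexx.
  by congr Some; rewrite mul1r; field.
exists (closure ray); split.
- apply/connected_closure/line_connected => x y /= x1 _ t /andP[xt _].
  exact: le_trans xt.
- move=> [w|//] cw /=.
  suff : cabs (ell z) <= cabs (ell w) by apply: lt_le_trans.
  rewrite leNgt; apply/negP => wz.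
  have [|_ [[t t1 <-] [v [<-]]]] := cw [set x : sphere | exists2 v, x = Some v & cabs (ell v) < cabs (ell z)].
    apply/nbhs_Some_ell; exists (cabs (ell z) - cabs (ell w)); first by rewrite subr_gt0.
    move=> v vw; exists v => //; have := cabsB (ell v) (ell w); lra.
  rewrite ellray cabsM cabsr; rewrite /= in t1.
  rewrite ger0_norm; last by rewrite (le_trans ler01).
  by have := cabs_ge0 (ell z); nra.
- move=> B /nbhs_None_ell[_ [K KB]].
  have z0 : 0 < cabs (ell z) by apply: le_lt_trans fz.
  pose t := Num.max 1 (`|K| / cabs (ell z) + 1).
  have t1 : 1 <= t by rewrite le_max lexx.
  exists (Some (- d / c + t%:C%C * (z + d / c))); split.
    by exists t.
  apply: KB; rewrite ellray cabsM cabsr ger0_norm; last by rewrite (le_trans ler01).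
  rewrite -ltr_pdivrMr// (lt_le_trans (y := `|K| / cabs (ell z) + 1))//.
    by rewrite ltr_pwDr// ler_wpM2r ?invr_ge0 ?(ltW z0)// ler_norm.
  by rewrite le_max lexx orbT.
- exact: subset_closure.
Qed.

Lemma segment_escaping (z w : C) : complex.Re (ell z) = 0 -> complex.Re (ell w) = 0 ->
  segment z w `<=` escaping.
Proof.
move=> z0 w0 _ [t _ <-] /=; left.
have -> : ell (z + t%:C%C * (w - z)) = ell z + t%:C%C * (ell w - ell z).
  by rewrite /ell; field; rewrite stM_scale_neq0.
case: (ell z) (ell w) z0 w0 => [a1 b1] [a2 b2] /= -> ->.
by rewrite subrr !mulr0 mul0r subr0 addr0.
Qed.

(** A point common to the imaginary axis and [far 3], from which segments attach further points to
    [far 3]. *)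
Let i4 := ellV (0 +i* 4)%C.

Let i4_far : far 3 (Some i4).
Proof.
rewrite /= ellVK /cabs/= expr0n add0r sqrtr_sqr ger0_norm//.
by rewrite ltr_nat.
Qed.

Lemma connected_to_far (z : C) (S : set sphere) : far 3 `<=` S ->
  segment i4 z `<=` S -> exists A, [/\ connected A, A `<=` S, A None & A (Some z)].
Proof.
move=> fS sS; exists (far 3 `|` segment i4 z); split.
- apply: connectedU; [|exact: far_connected|exact: segment_connected].
  by exists (Some i4); split; [exact: i4_far|exact: segment_left].
- by rewrite subUset.
- by left.
- by right; exact: segment_right.
Qed.

Lemma escaping_connected : connected escaping.
Proof.
apply: (@star_connected _ _ (None : sphere)) => -[z|] ez; last first.
  by exists [set None]; split=> //; [exact: connected1|move=> _ ->].
have f3 : far 3 `<=` escaping by move=> x; exact: far_escaping.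
case: ez => [z0|z3].
  by apply: connected_to_far => //; apply: segment_escaping => //; rewrite ellVK.
by exists (far 3); split=> //; exact: far_connected.
Qed.

Lemma sphere_connected : connected [set: sphere].
Proof.
apply: (@star_connected _ _ (None : sphere)) => -[z|] _; last first.
  by exists [set None]; split=> //; exact: connected1.
by apply: connected_to_far.
Qed.

End Dynamics.

(** * Fatou components and the Julia set *)

Section FatouJulia.
Variables (R : realType) (b c d : R[i]).
Hypotheses (hb : b != 0) (hc : c != 0).
Local Notation C := R[i].
Local Notation sphere := (sphere R).
Local Notation F := (rat_eval (stM b c d)).
Local Notation sq := (stM_scale b c).
Local Notation ell := (stM_coord b c d).
Local Notation ellV := (stM_coordV b c d).
Local Notation far := (far b c d).
Local Notation escaping := (escaping b c d).

Lemma far_sdist (e : R) : 0 < e ->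
  exists M : R, forall x, far M x -> sdist x None < e.
Proof.
move=> e0; exists ((cabs c * (2 / e) + cabs d) / cabs sq) => -[z|]; last by rewrite sdistxx.
by move=> /(ell_large_inv hb hc) h; rewrite sdistC; exact: sdist_None_lt.
Qed.

(** [iterates_normal] admits any sequence of exponents, so bounded ones, which take some value
    infinitely often, are treated apart. *)
Lemma constant_or_unbounded (n_ : nat -> nat) :
  (exists m, forall N, exists2 k, (N <= k)%N & n_ k = m) \/
  (forall M N, exists2 k, (N <= k)%N & (M <= n_ k)%N).
Proof.
have [|nc] := pselect (exists m, forall N, exists2 k, (N <= k)%N & n_ k = m); first by left.
right => M N; apply: contrapT => nk.
have {nk} : exists N, forall k, (N <= k)%N -> (n_ k < M)%N.
  exists N => k Nk; rewrite ltnNge; apply/negP => Mk; apply: nk; by exists k.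
elim: M => [[K /(_ K (leqnn _))]//|M ih [K HK]].
apply: nc; exists M => N'; apply: contrapT => nM; apply: ih.
exists (maxn K N') => k; rewrite geq_max => /andP[Kk Nk].
rewrite ltn_neqAle -ltnS HK// andbT; apply/eqP => kM; apply: nM; by exists k.
Qed.

(** The points of the open set [V] are all in [far 3] after five steps and then gain one unit per
    step, so the iterates tend to infinity uniformly on [V]. *)
Lemma escaping_fatou : escaping `<=` fatou_set F.
Proof.
move=> x ex; pose V := iter 5 F @^-1` far 3.
have oV : sopen V.
  have cF : continuous (iter 5 F : sphere -> sphere) by exact: stM_iter_continuous.
  by rewrite sopenE; move/continuousP: cF; apply; exact: far_open.
exists V; split=> //; first exact: escaping_iter_far.
apply: frequent_iterates_normal => // n_.
have [[m Hm]|Hn] := constant_or_unbounded n_.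
  exists (iter m F) => e e0 N; have [k Nk km] := Hm N.
  by exists k => // y _; rewrite km sdistxx.
exists (fun=> None) => e e0 N; have [M HM] := far_sdist e0.
have [k Nk Mk] := Hn ((Num.bound `|M|) + 5)%N N.
exists k => // y Vy; apply: HM.
have -> : n_ k = (n_ k - 5 + 5)%N by rewrite subnK// (leq_trans _ Mk)// leq_addl.
rewrite iterD; have ey : escaping (iter 5 F y) by apply: far_escaping Vy.
have [_] := far_iter hb hc (n_ k - 5) ey Vy.
case: (iter _ F _) => [z|//] /=; apply: le_lt_trans.
have h1 := archi_boundP (normr_ge0 M); have h2 := ler_norm M.
have : (Num.bound `|M|)%:R <= (n_ k - 5)%:R :> R.
  by rewrite ler_nat -(leq_add2r 5) subnK// (leq_trans _ Mk)// leq_addl.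
lra.
Qed.

Lemma component_absorb (A K B : set sphere) : is_component A K -> connected B ->
  B `<=` A -> K `&` B !=set0 -> B `<=` K.
Proof.
move=> [KA _ cK Kmax] cB BA KB; rewrite -(Kmax (K `|` B)).
- by right.
- by left.
- by rewrite subUset.
- by rewrite sconnectedE; apply: connectedU => //; rewrite -sconnectedE.
Qed.

Lemma component_exists (A : set sphere) x : A x ->
  is_component A (connected_component A x).
Proof.
move=> Ax; split.
- exact: connected_component_sub.
- by exists x; exact: connected_component_refl.
- by rewrite sconnectedE; exact: component_connected.
- move=> L KL LA; rewrite sconnectedE => cL; apply/seteqP; split => //.
  by apply: connected_component_max => //; exact/KL/connected_component_refl.
Qed.

Lemma component_of_closed (A K : set sphere) : closed A -> is_component A K -> closed K.
Proof.
move=> cA [KA _ cK Kmax].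
rewrite closure_id; apply/esym/Kmax; first exact: subset_closure.
  by rewrite (closure_id A).1//; exact: closureS.
by rewrite sconnectedE; apply: connected_closure; rewrite -sconnectedE.
Qed.

(** * Normality on an open set whose orbits avoid [escaping] *)

Section BoundedOrbits.
Variable D : set sphere.
Hypothesis oD : open D.
Hypothesis D_escaping : forall n x, D x -> ~ escaping (iter n F x).

(* Numerator and denominator of ell \o F^n. *)
Fixpoint iter_ratio (n : nat) : {poly C} * {poly C} :=
  if n is m.+1 then
    let: (P, Q) := iter_ratio m in
    (2%:R *: P ^+ 4 - 2%:R *: (P ^+ 2 * Q ^+ 2) + Q ^+ 4, P ^+ 3 * Q)
  else ((c / sq) *: 'X + (d / sq)%:P, 1).

(** The denominators never vanish: a zero of the numerator would put the orbit on the pole, which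
    lies in [escaping]. *)
Lemma iter_ratioP n y : D (Some y) ->
  (iter_ratio n).2.[y] != 0 /\
  iter n F (Some y) = Some (ellV ((iter_ratio n).1.[y] / (iter_ratio n).2.[y])).
Proof.
move=> Dy; elim: n => [|n [Q0 ih]].
  rewrite /= hornerC oner_neq0; split=> //; congr Some.
  rewrite divr1 !hornerE -[LHS](ellK d hb hc); congr ellV.
  by rewrite /stM_coord; field; rewrite stM_scale_neq0.
move: (D_escaping (n := n) Dy); rewrite ih iterS ih /=.
case: (iter_ratio n) Q0 => P Q /= Q0; rewrite ellVK// => ne.
have P0 : P.[y] != 0.
  by apply/eqP => P0; apply: ne; left; rewrite P0 mul0r.
rewrite hornerM horner_exp !mulf_neq0 ?expf_neq0//; split=> //.
rewrite -/(F (Some _)) stM_eval_ell// ellVK// ?mulf_neq0 ?invr_eq0//; congr (Some (ellV _)).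
rewrite /normal_form !(hornerD, hornerN, hornerZ, hornerM, horner_exp).
by field; rewrite P0 Q0.
Qed.

(** Avoiding [escaping] bounds the coordinate of all iterates by 3. [ratio_lipschitz] makes them
    equicontinuous on a half-size disc, and [ascoli] applies. *)
Lemma bounded_orbits_fatou : D `<=` fatou_set F.
Proof.
move=> x Dx; case: x Dx => [z|] Dz; last by case: (D_escaping (n := 0) Dz).
have /nbhs_SomeP[r0 r00 r0D] : nbhs (Some z : sphere) D by exact: open_nbhs_nbhs.
pose r := r0 / 2; have r_gt0 : 0 < r by rewrite divr_gt0.
have rD y : cabs (y - z) <= r -> D (Some y).
  by move=> yr; apply: r0D; rewrite (le_lt_trans yr)// /r; lra.
pose f k y := (iter_ratio k).1.[y] / (iter_ratio k).2.[y].
have fB k y : cabs (y - z) <= r -> cabs (f k y) <= 3.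
  move=> /rD Dy; rewrite leNgt; apply/negP => h; apply: (D_escaping (n := k) Dy).
  by have [_ ->] := iter_ratioP k Dy; right; rewrite ellVK.
have fL k y w : cabs (y - z) <= r / 2 -> cabs (w - z) <= r / 2 ->
    cabs (f k y - f k w) <= 4 * 3 / r * cabs (y - w).
  apply: ratio_lipschitz => //; last exact: fB.
  by move=> v /rD Dv; have [] := iter_ratioP k Dv.
pose V : set sphere := [set x | exists2 w, x = Some w & cabs (w - z) < r / 2].
have oV : sopen V.
  rewrite sopenE openE => _ [w -> wz].
  apply/nbhs_SomeP; exists (r / 2 - cabs (w - z)); first by rewrite subr_gt0.
  by move=> v vw; exists v => //; have := cabs_dist_trans w v z; lra.
exists V; split=> //.
- by exists z => //; rewrite subrr cabs0 divr_gt0.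
apply: frequent_iterates_normal => // n_.
have L0 : 0 <= 4 * 3 / r by rewrite divr_ge0 ?mulr_ge0// ltW.
have [|||g Hg] := @ascoli R z (r / 2) (4 * 3 / r) 3 (f \o n_) _ L0.
- by rewrite divr_ge0 ?ltW.
- by move=> k y yr; apply: fB; lra.
- by move=> k y w; exact: fL.
exists (fun x => if x is Some y then Some (ellV (g y)) else None) => e e0 N.
have q0 : 0 < 2 * cabs (sq / c).
  by rewrite mulr_gt0// cabs_gt0 mulf_neq0 ?invr_eq0 ?stM_scale_neq0.
have [|k Nk Hk] := Hg (e / (2 * cabs (sq / c))) _ N; first by rewrite divr_gt0.
exists k => // _ [y -> yr].
have Dy : D (Some y) by apply: rD; lra.
have [_ ->] := iter_ratioP (n_ k) Dy.
rewrite (le_lt_trans (sdist_Some_le _ _))//.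
have -> : ellV (f (n_ k) y) - ellV (g y) = sq / c * (f (n_ k) y - g y).
  by rewrite /stM_coordV; field.
rewrite cabsM mulrA mulrC -ltr_pdivlMr//; apply: Hk; exact: ltW.
Qed.

End BoundedOrbits.

(** Otherwise [U] would absorb [far 3] and contain the fixed point infinity. Its image under [phi]
    is nonzero and fixed by the rotation, which is therefore trivial; [iter p F] would then be the
    identity on [U], against the growth in [far 3]. *)
Lemma herman_not_escaping (U : set sphere) n x :
  herman_ring F U -> U x -> ~ escaping (iter n F x).
Proof.
move=> [compU _ [p [p0 pU _ [r1 [r2 [theta [phi [[r12 _] _ phi_inj phiU phiF]]]]]]]] Ux en.
have Uk k : U (iter (k * p) F x).
  elim: k => [//|k ih]; rewrite mulSn iterD -pU; by exists (iter (k * p) F x).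
have f3U : far 3 `<=` U.
  apply: (component_absorb compU).
  - exact: far_connected.
  - by move=> y /far_escaping ey; apply: escaping_fatou; exact: ey.
  (* A multiple of [p] keeps the point in [U], and this one leaves at least five steps after time
     [n] to reach [far 3]. *)
  exists (iter ((n + 5) * p) F x); split => //.
  have np : (n + 5 <= (n + 5) * p)%N by rewrite leq_pmulr.
  have -> : ((n + 5) * p)%N = (5 + ((n + 5) * p - (n + 5)) + n)%N.
    by rewrite -[LHS](subnK np) [(n + 5)%N]addnC addnA [(_ + 5)%N]addnC.
  rewrite iterD iterD; apply: escaping_iter_far => //.
  elim: (_ - _)%N => //= m ih; exact: escaping_stM.
have UN : U None by exact: f3U.
have FN : iter p F None = None by elim: (p) => //= m ->; exact: stM_eval_None.
have rot1 : rotation_factor theta = 1.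
  have := phiF _ UN; rewrite FN => h.
  have pN : phi None != 0.
    have : [set w | r1 < cabs w < r2] (phi None) by rewrite -phiU; exists None.
    rewrite /= -cabs_gt0 => /andP[+ _]; apply: lt_trans; by case/andP: r12.
  by apply: (mulIf pN); rewrite mul1r -h.
(* This point lies in [far 3] but not in [far (3 + p)], so it cannot be fixed by [iter p F]. *)
pose y : sphere := Some (ellV (4%:R)).
have fy (M : R) : far M y = (M < 4) by rewrite /= ellVK// cabs_nat.
have f3y : far 3 y by rewrite fy; lra.
have Uy : U y by exact: f3U.
have ey : escaping y by exact: far_escaping f3y.
have Up : U (iter p F y) by rewrite -pU; exists y.
have : iter p F y = y.
  by apply: phi_inj; rewrite ?inE// phiF// rot1 mul1r.
have [_ +] := far_iter hb hc p ey f3y => /[swap] ->; rewrite fy.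
have : (1 : R) <= p%:R by rewrite ler1n.
lra.
Qed.

Lemma no_herman_ring (U : set sphere) : ~ herman_ring F U.
Proof.
move=> hU; have [compU [K1 [K2 [cK1 cK2 K12 Kall]]] _] := hU.
have [UF _ _ _] := compU.
have Uesc n x : U x -> ~ escaping (iter n F x) by exact: herman_not_escaping.
have oU : open U.
  rewrite openE => -[z|] Uz; last by case: (Uesc 0%N _ Uz).
  have [V [oV Vz nV]] := UF _ Uz.
  have VF : V `<=` fatou_set F by move=> y Vy; exists V.
  move: oV; rewrite sopenE => oV.
  have /nbhs_SomeP[r r0 rV] : nbhs (Some z : sphere) V by exact: open_nbhs_nbhs.
  apply/nbhs_SomeP; exists r => // w wz.
  apply: (component_absorb compU (@disc_connected R z r)).
  - by move=> _ [v -> vz]; apply: VF; exact: rV.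
  - by exists (Some z); split => //; exists z => //; rewrite subrr cabs0.
  - by exists w.
have cU : closed (~` U) by exact: open_closedC.
have K12U x : ~ U x -> K1 x \/ K2 x.
  move=> Ux; have cx := component_exists (Ux : (~` U) x).
  have Kx : connected_component (~` U) x x by exact: connected_component_refl.
  by have [E|E] := Kall _ cx; rewrite E in Kx; [left|right].
have escU : escaping `<=` ~` U by move=> x ex Ux; exact: (Uesc 0%N x).
wlog K1N : K1 K2 cK1 cK2 K12 {Kall} K12U / K1 None.
  move=> W; have [|K1N|K2N] := K12U None; first exact: escU.
    exact: (W K1 K2).
  apply: (W K2 K1) => //; first exact: nesym.
  by move=> x /K12U[]; [right|left].
have escK1 : escaping `<=` K1.
  apply: (component_absorb cK1) => //; first exact: escaping_connected.
  by exists None.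
have disj x : K1 x -> K2 x -> False.
  move=> K1x K2x; apply: K12; have [K1U _ c1 _] := cK1; have [K2U _ c2 _] := cK2.
  move: c1 c2; rewrite !sconnectedE => c1 c2; apply/seteqP; split.
    by apply: (component_absorb cK2) => //; exists x.
  by apply: (component_absorb cK1) => //; exists x.
have [K1U _ _ _] := cK1; have [K2U [x2 K2x2] _ _] := cK2.
have closedK2 : closed K2 by exact: component_of_closed cK2.
(* [D] is [U] with the hole [K2] filled in. *)
pose D := ~` K1.
have oD : open D by apply: closed_openC; exact: component_of_closed cK1.
have UD : U `<=` D by move=> x Ux /K1U.
have K2D : K2 `<=` D by move=> x K2x /disj; exact.
have DK2 x : D x -> ~ U x -> K2 x by move=> Dx /K12U[/Dx|].
(* Openness of the images is part of the induction: [stM_open] applies away from the pole, which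
   belongs to [escaping]. *)
have Dstep n : (forall x, D x -> ~ escaping (iter n F x)) /\ open (iter n F @` D).
  elim: n => [|n [ihe iho]].
    split=> [x Dx /escK1/Dx//|]; rewrite (_ : iter 0 F @` D = D)//.
    by apply/seteqP; split => [_ [x Dx <-]//|x Dx]; exists x.
  have iho' : open (iter n.+1 F @` D).
    rewrite openE => _ [x Dx <-].
    suff : nbhs (iter n.+1 F x) (iter n.+1 F @` D) by [].
    have := ihe _ Dx; rewrite iterS; case Ez : (iter n F x) => [z|] ne; last by case: ne.
    have z0 : ell z != 0 by apply/eqP => z0; apply: ne; left; rewrite z0.
    have nz : nbhs (Some z : sphere) (iter n F @` D).
      by apply: open_nbhs_nbhs; split => //; exists x.
    have := stM_open hb hc z0 nz; apply: filterS => _ [_ [y Dy <-] <-].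
    by exists y.
  split=> // x Dx ex.
  (* Orbits from [U] contribute nothing here, so the trace on [escaping] of an open set is also that
     of a compact one. *)
  have BE : escaping `&` iter n.+1 F @` D = escaping `&` iter n.+1 F @` K2.
    apply/seteqP; split => w [ew [y Yy yw]]; split => //; exists y => //.
      by apply: DK2 => // Uy; apply: (Uesc n.+1 y Uy); rewrite yw.
    exact: K2D.
  have : escaping `&` iter n.+1 F @` D = escaping.
    apply: (escaping_connected hb hc).
    - by exists (iter n.+1 F x); split => //; exists x.
    - by exists (iter n.+1 F @` D).
    - exists (iter n.+1 F @` K2) => //.
      apply: compact_closed; first exact: sphere_hausdorff.
      apply: continuous_compact; first exact/continuous_subspaceT/stM_iter_continuous.
      exact: subclosed_compact closedK2 (@sphere_compact R) _.
  move/seteqP => [_ /(_ None I)[_ [y Dy]]] /= /(stM_eval_eq_None hb hc)[E|[z E z0]].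
    by apply: (ihe y Dy); rewrite E.
  by apply: (ihe y Dy); rewrite E; left; rewrite z0.
have DF : D `<=` fatou_set F.
  by apply: bounded_orbits_fatou => // n; exact: (Dstep n).1.
(* The closed set [K2] has a boundary point, since the sphere is connected and [K2] is nonempty and
   misses infinity. *)
have [x0 K2x0 nx0] : exists2 x, K2 x & ~ nbhs x K2.
  apply: contrapT => h; have oK2 : open K2.
    by rewrite openE => x K2x; apply: contrapT => nx; apply: h; exists x.
  have : K2 = setT.
    apply: (@sphere_connected R b c d hb hc); first by exists x2.
      by exists K2; rewrite ?setTI.
    by exists K2; rewrite ?setTI.
  by move=> K2T; apply: (disj None) => //; rewrite K2T.
case: x0 K2x0 nx0 => [z|] K2z nz; last exact: (disj None).
have /nbhs_SomeP[r r0 rD] : nbhs (Some z : sphere) D.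
  by apply: open_nbhs_nbhs; split => //; exact: K2D.
(* A disc about [z] inside [D] is in the Fatou set; if it met [U], it would be absorbed by [U]
   together with its centre, which is in [K2]. *)
apply: nz; apply/nbhs_SomeP; exists r => // w wr.
apply: (DK2 _ (rD _ wr)) => Uw; apply: (K2U _ K2z).
apply: (component_absorb compU (@disc_connected R z r)).
- by move=> _ [v -> vz]; apply: DF; exact: rD.
- by exists (Some w); split => //; exists w.
- by exists z => //; rewrite subrr cabs0.
Qed.

(** * The parabolic fixed points and the disconnectedness of the Julia set *)

(** The radius [2 A + 1] ensures [1 + |v| <= 2 |v - w|], which cancels the factor [1 + |v|] in
    [sdist_Some_ge]. *)
Lemma sdist_bounded_far (w v : C) (A : R) : 0 <= A ->
  cabs w <= A -> 2 * A + 1 <= cabs v -> (1 + A)^-1 <= sdist (Some w) (Some v).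
Proof.
move=> A0 wA vA; apply: le_trans (sdist_Some_ge _ _).
have w0 := cabs_ge0 w; have := cabsB v w; rewrite cabs_distC.
move: (cabs (w - v)) (cabs w) (cabs v) wA vA w0 => t a u wA vA w0 tv.
rewrite ler_pdivlMr ?mulr_gt0//; try lra.
rewrite mulrC ler_pdivrMr; last lra.
nra.
Qed.

(** This is [normal_form] on the real line, with the displacement isolated: it vanishes doubly at 1
    and is positive for [t > 1]. *)
Definition real_orbit (t : R) : R := t + (t ^+ 2 - 1) ^+ 2 / t ^+ 3.

(** The normal form is odd, so the sign [s] treats both fixed points at once. *)
Lemma stM_real_orbit (s t : R) : s ^+ 2 = 1 -> t != 0 ->
  F (Some (ellV (s * t)%:C%C)) = Some (ellV (s * real_orbit t)%:C%C).
Proof.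
move=> s2 t0; have s0 : s != 0 by rewrite -sqrf_eq0 s2 oner_neq0.
have st0 : s * t != 0 by rewrite mulf_neq0.
have stC0 : ((s * t)%:C)%C != 0 :> C by rewrite fmorph_eq0.
have e (w : C) : ell (ellV w) = w by exact: ellVK.
rewrite stM_eval_ell ?e//; congr (Some (ellV _)).
have -> : normal_form (s * t)%:C%C = (2 * (s * t) - 2 / (s * t) + ((s * t) ^+ 3)^-1)%:C%C.
  by rewrite /normal_form !(rmorphD, rmorphN, rmorphM, rmorphXn, fmorphV, rmorph_nat)/=.
congr (_%:C)%C; rewrite /real_orbit.
have -> : 2 / (s * t) = 2 * s / (s ^+ 2 * t) by field; rewrite s0 t0.
have -> : ((s * t) ^+ 3)^-1 = s / ((s ^+ 2) ^+ 2 * t ^+ 3) by field; rewrite s0 t0.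
by rewrite s2; field.
Qed.

(** The displacement at [x] is at least [(x - 1)^2 / x], which increases for [x > 1]; every step
    thus gains at least the value of this bound at [t]. *)
Lemma real_orbit_ge (t : R) : 1 < t ->
  forall n, 1 + (t - 1) + n%:R * ((t - 1) ^+ 2 / t) <= iter n real_orbit t.
Proof.
move=> t1; have d0 : 0 < (t - 1) ^+ 2 / t.
  by rewrite divr_gt0 ?exprn_gt0 ?subr_gt0//; lra.
elim=> [|n ih]; first by rewrite mul0r addr0 /=; lra.
rewrite iterS; set x := iter n real_orbit t in ih *.
have tx : t <= x.
  apply: le_trans ih; have : 0 <= n%:R * ((t - 1) ^+ 2 / t).
    by rewrite mulr_ge0// ltW.
  lra.
have x0 : 0 < x by lra.
suff : (t - 1) ^+ 2 / t <= (x ^+ 2 - 1) ^+ 2 / x ^+ 3.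
  rewrite /real_orbit -natr1; lra.
apply: (@le_trans _ _ ((x - 1) ^+ 2 / x)).
  have t0 : 0 < t by lra.
  rewrite ler_pdivrMr// mulrAC ler_pdivlMr// -subr_ge0.
  have -> : (x - 1) ^+ 2 * t - (t - 1) ^+ 2 * x = (x - t) * (x * t - 1) by ring.
  by rewrite mulr_ge0 ?subr_ge0//; nra.
have -> : (x ^+ 2 - 1) ^+ 2 / x ^+ 3 = ((x - 1) ^+ 2 / x) * ((x + 1) / x) ^+ 2.
  by field; rewrite gt_eqF.
apply: ler_peMr; first by rewrite divr_ge0 ?sqr_ge0 ?(ltW x0).
by rewrite exprn_ege1// ler_pdivlMr//; lra.
Qed.

Lemma stM_iter_real_orbit (s t : R) n : s ^+ 2 = 1 -> 1 < t ->
  iter n F (Some (ellV (s * t)%:C%C)) = Some (ellV (s * iter n real_orbit t)%:C%C).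
Proof.
move=> s2 t1; elim: n => [//|n ih]; rewrite !iterS ih stM_real_orbit//.
have := real_orbit_ge t1 n; have : 0 <= n%:R * ((t - 1) ^+ 2 / t).
  by rewrite mulr_ge0// divr_ge0 ?sqr_ge0//; lra.
by move=> h1 h2; rewrite gt_eqF//; lra.
Qed.

(* Near the parabolic fixed point s the points ell^-1 (s t), t > 1, all escape to
   infinity, so that no subsequence of iterates has a continuous limit there. *)
Lemma parabolic_julia (s : R) : s ^+ 2 = 1 -> julia_set F (Some (ellV s%:C%C)).
Proof.
move=> s2 [V [oV Vx nV]]; have [phi [phi_incr [g Hg]]] := nV id.
have [W [oW Wx WV HW]] := Hg _ Vx.
have phi_ge k : (k <= phi k)%N.
  by elim: k => // k ih; exact: leq_ltn_trans ih (phi_incr k).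
have s0 : `|s| = 1.
  by apply/eqP; rewrite -(@eqrXn2 _ 2) ?expr1n// real_normK ?num_real// s2.
pose A := (cabs sq * 2 + cabs d) / cabs c.
have c0 : 0 < cabs c by rewrite cabs_gt0.
have A0 : 0 <= A by rewrite divr_ge0 ?addr_ge0 ?mulr_ge0 ?cabs_ge0.
(* Coordinates below 2 give moduli at most [A]. This tolerance serves [sdist_bounded_far] twice:
   with [A], to bound the limit by [2 A + 1], then with [2 A + 1], to separate the limit from a late
   iterate. *)
have eA : 0 < (1 + (2 * A + 1))^-1 by rewrite invr_gt0; lra.
have [N HN] := HW _ eA.
pose x0 : sphere := Some (ellV s%:C%C).
have fixF n : iter n F x0 = x0.
  elim: n => // n ih; rewrite iterS ih.
  have := stM_real_orbit s2 (oner_neq0 R).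
  by rewrite /real_orbit expr1n subrr expr0n mul0r addr0 mulr1.
pose B := [set x : sphere | exists2 w, x = Some w & cabs (ell w) < 2].
(* By continuity, points close enough to the fixed point are still near it at time [phi N], although
   they escape later. *)
have near0 : nbhs x0 (W `&` iter (phi N) F @^-1` B).
  apply: filterI; first by apply: open_nbhs_nbhs; split=> //; rewrite -sopenE.
  have cF : continuous (iter (phi N) F : sphere -> sphere) by exact: stM_iter_continuous.
  apply: (cF x0 B); rewrite fixF; apply/(nbhs_Some_ell d hb hc); exists 1 => // w.
  rewrite ellVK// => h; exists w => //.
  by have := cabsB (ell w) s%:C%C; rewrite cabsr s0; lra.
have [r r0 rW] := (nbhs_Some_ell d hb hc _ _).1 near0.
pose t := 1 + r / 2; have t1 : 1 < t by rewrite /t; lra.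
pose y : sphere := Some (ellV (s * t)%:C%C).
have [Wy [w yw w2]] : (W `&` iter (phi N) F @^-1` B) y.
  apply: rW; rewrite !ellVK// -rmorphB/= cabsr.
  have -> : s * t - s = s * (r / 2) by rewrite /t; ring.
  by rewrite normrM s0 mul1r ger0_norm; lra.
have wA : cabs w <= A.
  by rewrite leNgt; apply/negP => /(ell_large hb hc); lra.
have h1 : sdist (Some w) (g y) < (1 + (2 * A + 1))^-1 by rewrite -yw; exact: HN.
have hA : (1 + (2 * A + 1))^-1 <= (1 + A)^-1 by rewrite lef_pV2 ?posrE; lra.
case Eg : (g y) h1 => [v|] h1; last first.
  move: h1; rewrite /= ltNge => /negP; apply; apply: (le_trans hA).
  rewrite -[X in X <= _]mul1r ler_pM ?invr_ge0 ?ler1n//; first lra.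
  rewrite lef_pV2 ?posrE ?sqrtD1_gt0//; last lra.
  by rewrite (le_trans (sqrtD1_le (cabs_ge0 w)))// lerD2l.
have vA : cabs v < 2 * A + 1.
  rewrite ltNge; apply/negP => vA; have := sdist_bounded_far A0 wA vA; lra.
(* A coordinate beyond [K] forces a modulus beyond [2 (2 A + 1) + 1]. *)
pose K := (cabs c * (2 * (2 * A + 1) + 1) + cabs d) / cabs sq.
have K0 : 0 <= K by rewrite divr_ge0 ?cabs_ge0// addr_ge0 ?mulr_ge0 ?cabs_ge0//; lra.
have del0 : 0 < (t - 1) ^+ 2 / t by rewrite divr_gt0 ?exprn_gt0 ?subr_gt0//; lra.
pose n := maxn N (Num.bound (K / ((t - 1) ^+ 2 / t))).
have nK : K < iter (phi n) real_orbit t.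
  apply: lt_le_trans (real_orbit_ge t1 _).
  have : K < (phi n)%:R * ((t - 1) ^+ 2 / t); last by lra.
  have del_ge0 := divr_ge0 K0 (ltW del0).
  rewrite -ltr_pdivrMr// (lt_le_trans (archi_boundP del_ge0))// ler_nat.
  by rewrite (leq_trans _ (phi_ge n))// leq_maxr.
have := HN n (leq_maxl _ _) y Wy; rewrite stM_iter_real_orbit// Eg.
set u := ellV _; rewrite sdistC ltNge => /negP; apply.
apply: sdist_bounded_far; [lra|exact: ltW|apply: ltW].
apply: (@ell_large_inv R b c d hb hc); rewrite /u ellVK// cabsr normrM s0 mul1r.
by rewrite (lt_le_trans nK)// ler_norm.
Qed.

Lemma julia_disconnected : ~ sconnected (julia_set F).
Proof.
apply; exists [set x : sphere | if x is Some z then 0 < complex.Re (ell z) else False],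
  [set x : sphere | if x is Some z then complex.Re (ell z) < 0 else False].
have ReB (u v : C) : complex.Re (u - v) = complex.Re u - complex.Re v by case: u v => [? ?] [].
have near (z w : C) : cabs (ell w - ell z) < `|complex.Re (ell z)| ->
    `|complex.Re (ell w) - complex.Re (ell z)| < `|complex.Re (ell z)|.
  by move=> h; rewrite -ReB (le_lt_trans (cabs_Re _)).
split.
- split; rewrite sopenE openE => -[z|//] /= h; apply/(nbhs_Some_ell d hb hc);
    exists `|complex.Re (ell z)|; rewrite ?normr_gt0 ?(gt_eqF h) ?(lt_eqF h)// => w /near.
    by rewrite [X in _ < X]gtr0_norm// ltr_norml => /andP[] /=; lra.
  by rewrite [X in _ < X]ltr0_norm// ltr_norml => /andP[] /=; lra.
- case=> [z|] Jz; last by case: Jz; exact: escaping_fatou.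
  have [h|h|h] := ltrgtP (complex.Re (ell z)) 0; [by right|by left|].
  by case: Jz; apply: escaping_fatou; left.
- exists (Some (ellV (1%:C)%C)); split; first by apply: parabolic_julia; rewrite expr1n.
  by rewrite /= ellVK.
- exists (Some (ellV ((-1)%:C)%C)); split; first by apply: parabolic_julia; rewrite sqrrN expr1n.
  by rewrite /= ellVK//= oppr_lt0.
- by apply/seteqP; split => // -[z|] [[_ //=]]; lra.
Qed.

End FatouJulia.

Theorem theorem4p1 (R : realType) (b c d : R[i]) (hb : b != 0) (hc : c != 0) :
  let F := rat_eval (stM b c d) in
  (* St_M is Stirling's method for M *)
  (forall z : R[i], c * z + d != 0 -> c * (z - moebM b c d z) + d != 0 ->
     F (Some z) = Some (z - moebM b c d z /
                     derive1 (moebM b c d : R[i]^o -> R[i]^o) (z - moebM b c d z))) /\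
  (* (i) *)
  (is_rational_map (stM b c d) /\ rdeg (stM b c d) = 4%N /\
   num_crit_points (stM b c d) 6) /\
  (* (ii) *)
  (attracting_fixed_infty F /\
   is_derive (0 : R[i]^o) (1 : R[i]^o) (chart_infty F : R[i]^o -> R[i]^o) (1 / 2)) /\
  (* (iii) at most one cycle of Herman rings *)
  (forall U V, herman_ring F U -> herman_ring F V ->
     exists k : nat, iter k F @` U = V) /\
  (* (iv) *)
  ~ sconnected (julia_set F).
Proof.
move=> F; split; first by move=> z; exact: stM_stirling.
split; first by split; [exact: stM_rational|split; [exact: rdeg_stM|exact: stM_num_crit_points]].
split; first by split; [exact: stM_attracting_infty|exact: stM_multiplier_infty].
split; last exact: julia_disconnected.
by move=> U V /(no_herman_ring hb hc).
Qed.
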